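(* Let $Y$ be a Banach function space on $X$ satisfying property (Y), let $v\ge 1$ be a weight on $X$ with associated weight $m=m_v$ on $X\times X$, and let $\mathcal U=\{U_i\}_{i\in I}$ be a moderate admissible covering of $X$ with $\chi_{U_i}\in Y$ for all $i$, with $\sup_{i\in I}\sup_{x,y\in U_i}m(x,y)<\infty$, and such that $Y^\sharp\subset (L_\infty^{1/v})^\sharp$. Let $\mathcal F=\{\varphi_x\}_{x\in X}$ be a tight continuous frame for $\mathcal H$ satisfying $(F_{v,Y})$ and put $\mathsf{Co}\,Y=\mathsf{Co}(\mathcal F,Y)$. Let $n\in\mathbb N$ and let $\mathcal G_r=\{\psi^r_x\}_{x\in X}$ and $\tilde{\mathcal G}_r=\{\tilde\psi^r_x\}_{x\in X}$, $r=1,\dots,n$, be continuous frames for $\mathcal H$ contained in $\mathcal H^1_v$, such that the kernels $$K_r(x,y)=\sup_{z\in Q_x}|\langle\varphi_y,\psi^r_z\rangle|\qquad\text{and}\qquad \tilde K_r^*(x,y):=\tilde K_r(y,x),\quad \tilde K_r(x,y)=\sup_{z\in Q_x}|\langle\varphi_y,\tilde\psi^r_z\rangle|,$$ belong to $\mathcal B_{Y,m}$ for all $r$, where $Q_x=\bigcup_{i:\,x\in U_i}U_i$. Let $x_i\in U_i$ for $i\in I$ and assume that $$f=\sum_{r=1}^n\sum_{i\in I}\langle f,\psi^r_{x_i}\rangle\,\tilde\psi^r_{x_i}\qquad(\ast)$$ holds for all $f\in\mathcal H$. Then: (1) The expansion $(\ast)$ extends to all $f\in\mathsf{Co}\,Y$.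 (2) An element $f\in(\mathcal H^1_v)^\sim$ belongs to $\mathsf{Co}\,Y$ if and only if $\{\langle f,\psi^r_{x_i}\rangle\}_{i\in I}\in Y^\sharp$ for each $r=1,\dots,n$, and in this case $$\|f|\mathsf{Co}\,Y\|\asymp\sum_{r=1}^n\big\|\{\langle f,\psi^r_{x_i}\rangle\}_{i\in I}\big|Y^\sharp\big\|$$ with constants independent of $f$. (3) The convergence in $(\ast)$ (for $f\in \mathsf{Co}\,Y$) is in the norm of $\mathsf{Co}\,Y$ if the finite sequences are dense in $Y^\sharp$, and in general it is weak$^*$-convergence in $(\mathcal H^1_v)^\sim$.
   Context: $\mathcal H$ is a separable Hilbert space; $X$ is a locally compact Hausdorff space with a positive Radon measure $\mu$, $\operatorname{supp}\mu=X$. A family $\{\psi_x\}_{x\in X}\subset\mathcal H$ is a continuous frame if there are $0<C_1,C_2<\infty$ with $C_1\|f\|^2\le\int_X|\langle f,\psi_x\rangle|^2d\mu(x)\le C_2\|f\|^2$ for all $f\in\mathcal H$; throughout it is assumed that $\|\psi_x\|\le C$ for all $x$. Tight means $C_1=C_2$, normalized to $C_1=C_2=1$. Weighted spaces: $\|F|L_p^w(X,\mu)\|=(\int_X|wF|^pd\mu)^{1/p}$, and $F\in L_\infty^{w}$ iff $wF$ is essentially bounded. $L_1^{loc}(X,\mu)$ consists of the functions integrable over every subset of finite measure. Property (Y): $Y$ is a non-trivial Banach space of functions on $X$, contained in $L_1^{loc}(X,\mu)$ and solid: if $F$ is measurable, $G\in Y$ and $|F|\le|G|$ a.e., then $F\in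 Y$ and $\|F|Y\|\le\|G|Y\|$. For a weight $v\ge1$ on $X$, $m_v(x,y)=\max\{v(x)/v(y),v(y)/v(x)\}$. A measurable kernel $K:X\times X\to\mathbb C$ belongs to $\mathcal A_m$ if $$\|K|\mathcal A_m\|=\max\Big\{\operatorname*{ess\,sup}_{x}\int_X|K(x,y)|m(x,y)d\mu(y),\ \operatorname*{ess\,sup}_{y}\int_X|K(x,y)|m(x,y)d\mu(x)\Big\}<\infty.$$ $K$ acts by $K(F)(x)=\int_XK(x,y)F(y)d\mu(y)$. $\mathcal B_{Y,m}$ is the set of $K\in\mathcal A_m$ that are bounded from $Y$ to $Y$, with norm $\max\{\|K|\mathcal A_m\|,\|K|Y\to Y\|\}$. For a tight continuous frame $\mathcal F=\{\varphi_x\}$: $V_{\mathcal F}f(x)=\langle f,\varphi_x\rangle$, $R_{\mathcal F}(x,y)=\langle\varphi_y,\varphi_x\rangle$. Property $(F_{v,Y})$: $R_{\mathcal F}\in\mathcal B_{Y,m_v}$ and $R_{\mathcal F}(Y)$ is continuously embedded into $L_\infty^{1/v}(X,\mu)$. $\mathcal H^1_v=\{f\in\mathcal H: V_{\mathcal F}f\in L_1^v\}$ with norm $\|V_{\mathcal F}f|L_1^v\|$, and $(\mathcal H^1_v)^\sim$ is its anti-dual (bounded conjugate-linear functionals). For $f\in(\mathcal H^1_v)^\sim$ and $g\in\mathcal H^1_v$ write $\langle f,g\rangle=f(g)$, and $V_{\mathcal F}f(x)=f(\varphi_x)$. The coorbit space is $\mathsf{Co}(\mathcal F,Y)=\{f\in(\mathcal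 H^1_v)^\sim: V_{\mathcal F}f\in Y\}$ with $\|f|\mathsf{Co}\,Y\|=\|V_{\mathcal F}f|Y\|$. An admissible covering $\mathcal U=\{U_i\}_{i\in I}$ of $X$: each $U_i\subset X$ is relatively compact with non-void interior, $X=\bigcup_iU_i$, and $\sup_j\sharp\{i: U_i\cap U_j\ne\emptyset\}<\infty$. It is moderate if moreover $\mu(U_i)\ge D>0$ for all $i$, and there is $\tilde C$ with $\mu(U_i)\le\tilde C\mu(U_j)$ whenever $U_i\cap U_j\neq\emptyset$. For a space $Y$ satisfying (Y) and containing all $\chi_{U_i}$, $Y^\sharp=Y^\sharp(\mathcal U)$ is the space of sequences with $\|\{\lambda_i\}|Y^\sharp\|=\|\sum_i|\lambda_i|\mu(U_i)^{-1}\chi_{U_i}|Y\|<\infty$; $(L_\infty^{1/v})^\sharp$ is this sequence space for $Y=L_\infty^{1/v}(X,\mu)$. *)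

(* Defs.v *)
From HB Require Import structures.
From mathcomp Require Import all_boot all_order all_algebra finmap sesquilinear.
From mathcomp Require Import complex.
From mathcomp Require Import all_classical all_reals all_analysis ess_sup_inf.
From mathcomp.analysis.showcase Require Import summability.

Set Implicit Arguments.
Unset Strict Implicit.
Unset Printing Implicit Defensive.

Import Order.TTheory GRing.Theory Num.Theory.
Import numFieldNormedType.Exports.

Local Open Scope classical_set_scope.
Local Open Scope ring_scope.

(** Norms over [R[i]] take their values in [R[i]]; [rnorm] is the real value.
    For [V := R[i]] it is the modulus. *)
Definition rnorm (R : realType) (V : normedZmodType R[i]) (x : V) : R :=
  complex.Re `|x|.
Arguments rnorm {R V} x.

Definition borel (X : ptopologicalType) : Type :=
  g_sigma_algebraType (@open X).
HB.instance Definition _ (X : ptopologicalType) := Measurable.on (borel X).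

Record radon_full_support (R : realType) (X : ptopologicalType)
    (mu : {measure set (borel X) -> \bar R}) : Prop := RadonFullSupport {
  radon_compact : forall K : set X, compact K -> (mu K < +oo)%E ;
  radon_outer : forall A : set (borel X), measurable A ->
    mu A = ereal_inf [set mu V | V in [set V : set X | open V /\ A `<=` V]] ;
  radon_inner : forall V : set X, open V ->
    mu V = ereal_sup [set mu K | K in [set K : set X | compact K /\ K `<=` V]] ;
  radon_support : forall V : set X, open V -> V !=set0 -> (0 < mu V)%E }.

(** [hilbert dot]: the form [dot] (linear in the first argument) induces the
    norm of the complete space [H]; moreover [H] is separable. *)
Definition separable_hilbert (R : realType) (H : completeNormedModType R[i])
    (dot : {dot H for @Num.conj R[i]}) : Prop :=
  (forall f : H, `|f| ^+ 2 = dot f f) /\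
  exists D : set H, countable D /\ dense D.

Section complex_functions.
Context {R : realType} {d : measure_display} {T : measurableType d}.

Definition cmeasurable (F : T -> R[i]) : Prop :=
  measurable_fun setT (fun x => complex.Re (F x)) /\
  measurable_fun setT (fun x => complex.Im (F x)).

Variable mu : {measure set T -> \bar R}.

Definition cintegral (F : T -> R[i]) : R[i] :=
  Complex (Rintegral mu setT (fun x => complex.Re (F x)))
          (Rintegral mu setT (fun x => complex.Im (F x))).

End complex_functions.

(** A normed space of complex functions (or sequences, or functionals) on [T]:
    its members and its norm.  The norm is only meaningful on members. *)
Record nspace (R : realType) (T : Type) := NSpace {
  nmem : set (T -> R[i]) ;
  nnorm : (T -> R[i]) -> R }.

Section spaces.
Context {R : realType} {X : ptopologicalType}.
Variable mu : {measure set (borel X) -> \bar R}.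

Definition weighted_Lp (p : \bar R) (w : X -> R) : nspace R X :=
  let N (F : X -> R[i]) :=
    Lnorm mu p (fun x : borel X => (w x * rnorm (F x))%:E) in
  NSpace [set F : X -> R[i] | cmeasurable (F : borel X -> R[i]) /\ (N F < +oo)%E]
         (fun F => fine (N F)).

Definition L1loc (F : X -> R[i]) : Prop :=
  cmeasurable (F : borel X -> R[i]) /\
  forall A : set (borel X), measurable A -> (mu A < +oo)%E ->
    mu.-integrable A (fun x => (rnorm (F x))%:E).

(** Members of [Y] are representatives; functions that agree almost everywhere
    are identified ([Y_solid] makes membership and norm independent of the
    representative, provided that it is measurable). *)
Record property_Y (Y : nspace R X) : Prop := PropertyY {
  Y_zero : nmem Y (fun=> 0) ;
  Y_lin : forall (a : R[i]) F G, nmem Y F -> nmem Y G ->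
    nmem Y (fun x => a * F x + G x) ;
  Y_norm_ge0 : forall F, nmem Y F -> 0 <= nnorm Y F ;
  Y_norm_eq0 : forall F, nmem Y F -> nnorm Y F = 0 ->
    {ae mu, forall x, F x = 0} ;
  Y_normZ : forall (a : R[i]) F, nmem Y F ->
    nnorm Y (fun x => a * F x) = rnorm a * nnorm Y F ;
  Y_normD : forall F G, nmem Y F -> nmem Y G ->
    nnorm Y (fun x => F x + G x) <= nnorm Y F + nnorm Y G ;
  Y_complete : forall u : nat -> X -> R[i], (forall k, nmem Y (u k)) ->
    (forall e : R, 0 < e -> exists N : nat, forall j k : nat,
        (N <= j)%N -> (N <= k)%N -> nnorm Y (fun x => u j x - u k x) < e) ->
    exists F, nmem Y F /\
      (fun k => nnorm Y (fun x => u k x - F x)) @ \oo --> (0 : R) ;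
  Y_nontrivial : exists F, nmem Y F /\ ~ {ae mu, forall x, F x = 0} ;
  Y_L1loc : forall F, nmem Y F -> L1loc F ;
  Y_solid : forall F G, cmeasurable (F : borel X -> R[i]) -> nmem Y G ->
    {ae mu, forall x, rnorm (F x) <= rnorm (G x)} ->
    nmem Y F /\ nnorm Y F <= nnorm Y G }.

Definition is_weight (v : X -> R) : Prop :=
  measurable_fun setT (v : borel X -> R) /\ forall x, 1 <= v x.

Definition assoc_weight (v : X -> R) (x y : X) : R :=
  Num.max (v x / v y) (v y / v x).

Definition Am_norm (m : X -> X -> R) (K : X -> X -> R[i]) : \bar R :=
  maxe (ess_sup mu (fun x : borel X =>
          \int[mu]_y (rnorm (K x y) * m x y)%:E)%E)
       (ess_sup mu (fun y : borel X =>
          \int[mu]_x (rnorm (K x y) * m x y)%:E)%E).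

Definition Am (m : X -> X -> R) (K : X -> X -> R[i]) : Prop :=
  cmeasurable (fun z : borel X * borel X => K z.1 z.2) /\
  (Am_norm m K < +oo)%E.

Definition kernel_op (K : X -> X -> R[i]) (F : X -> R[i]) (x : X) : R[i] :=
  cintegral mu (fun y : borel X => K x y * F y).

(** Boundedness includes the convergence, for almost every [x], of the integral
    that defines [kernel_op K F x]. *)
Definition kernel_bounded (Y : nspace R X) (K : X -> X -> R[i]) : Prop :=
  exists C : R, forall F, nmem Y F ->
    [/\ {ae mu, forall x : borel X, mu.-integrable setT
          (fun y : borel X => (rnorm (K x y * F y))%:E)},
        nmem Y (kernel_op K F) &
        nnorm Y (kernel_op K F) <= C * nnorm Y F].

Definition BYm (Y : nspace R X) (m : X -> X -> R) (K : X -> X -> R[i]) : Prop :=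
  Am m K /\ kernel_bounded Y K.

End spaces.

Section coorbit.
Context {R : realType} {X : ptopologicalType}.
Variable mu : {measure set (borel X) -> \bar R}.
Context {H : completeNormedModType R[i]}.
Variable dot : {dot H for @Num.conj R[i]}.

Definition frame_bounds (C1 C2 : R) (psi : X -> H) : Prop :=
  [/\ forall f : H, cmeasurable (fun x : borel X => dot f (psi x)),
      exists C : R, forall x, rnorm (psi x) <= C &
      forall f : H,
        ((C1 * rnorm f ^+ 2)%:E <= \int[mu]_x (rnorm (dot f (psi x)) ^+ 2)%:E)%E /\
        (\int[mu]_x (rnorm (dot f (psi x)) ^+ 2)%:E <= (C2 * rnorm f ^+ 2)%:E)%E].

Definition continuous_frame (psi : X -> H) : Prop :=
  exists C1 C2 : R, [/\ 0 < C1, 0 < C2 & frame_bounds C1 C2 psi].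

Definition tight_frame (psi : X -> H) : Prop := frame_bounds 1 1 psi.

Variable phi : X -> H.

Definition gramian (x y : X) : R[i] := dot (phi y) (phi x).

(** The image of [Y] under [kernel_op mu gramian] carries the norm of [Y]. *)
Definition property_F (v : X -> R) (Y : nspace R X) : Prop :=
  BYm mu Y (assoc_weight v) gramian /\
  let Linf := weighted_Lp mu +oo%E (fun x => (v x)^-1) in
  exists C : R, forall F, nmem Y F ->
    let G := kernel_op mu gramian F in
    nmem Linf G /\ nnorm Linf G <= C * nnorm Y G.

Variable v : X -> R.

Definition H1v : set H :=
  [set f | nmem (weighted_Lp mu 1%E v) (fun x => dot f (phi x))].

Definition H1v_norm (f : H) : R :=
  nnorm (weighted_Lp mu 1%E v) (fun x => dot f (phi x)).

(** A functional on [H1v] is represented by its extension by zero to [H], so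
    that equality of functionals is equality of functions.  The elements
    [phi x] belong to [H1v] only for almost every [x]; hence
    [fun x => f (phi x)] is the voice transform of [f], set to [0] on a null
    set. *)
Definition antidual : set (H -> R[i]) :=
  [set f | [/\ forall (a : R[i]) (g h : H), H1v g -> H1v h ->
                 f (a *: g + h) = a^* * f g + f h,
               exists C : R, forall g, H1v g -> rnorm (f g) <= C * H1v_norm g &
               forall g, ~ H1v g -> f g = 0]].

Definition to_antidual (f : H) : H -> R[i] :=
  fun g => if `[< H1v g >] then dot f g else 0.

Definition Co (Y : nspace R X) : nspace R H :=
  NSpace [set f : H -> R[i] | antidual f /\ nmem Y (fun x => f (phi x))]
         (fun f => nnorm Y (fun x => f (phi x))).

(** Unordered summation, in the norm of [H], for the weak-star topology of the
    anti-dual, and in the norm of [Co Y]. *)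
Definition sums_H {I : choiceType} (u : I -> H) (s : H) : Prop :=
  partial_sum u @ totally --> s.

Definition sums_weakstar {I : choiceType}
    (u : I -> H -> R[i]) (s : H -> R[i]) : Prop :=
  [/\ forall i, antidual (u i), antidual s &
      forall g, H1v g ->
        (fun J : {fset I} => partial_sum u J g : R[i]^o) @ totally
          --> (s g : R[i]^o)].

Definition sums_Co (Y : nspace R X) {I : choiceType}
    (u : I -> H -> R[i]) (s : H -> R[i]) : Prop :=
  [/\ forall i, nmem (Co Y) (u i), nmem (Co Y) s &
      (fun J : {fset I} => nnorm (Co Y) (s - partial_sum u J)) @ totally
        --> (0 : R)].

End coorbit.

(** [f] is the sum over [r] of the sums over [i] of [u r i], where the inner
    sums are understood in the sense of [sums]. *)
Definition double_sum {n : nat} {I : choiceType} {V : zmodType}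
    (sums : (I -> V) -> V -> Prop) (u : 'I_n -> I -> V) (f : V) : Prop :=
  exists s : 'I_n -> V, (forall r, sums (u r) (s r)) /\ f = \sum_r s r.

Section coverings.
Context {R : realType} {X : ptopologicalType} {I : choiceType}.
Variable mu : {measure set (borel X) -> \bar R}.
Variable U : I -> set X.

Definition admissible_covering : Prop :=
  [/\ forall i, compact (closure (U i)),
      forall i, interior (U i) !=set0,
      \bigcup_i U i = setT &
      exists N : nat, forall j, ([set i | U i `&` U j !=set0] #<= `I_N)%card].

Definition moderate_covering : Prop :=
  [/\ admissible_covering,
      exists D : R, 0 < D /\ forall i, (D%:E <= mu (U i))%E &
      exists C : R, forall i j, U i `&` U j !=set0 ->
        (mu (U i) <= C%:E * mu (U j))%E].

(** For an admissible covering the sum has finitely many nonzero terms. *)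
Definition sharp_fun (a : I -> R[i]) (x : X) : R :=
  \sum_(i \in [set: I]) rnorm (a i) * (fine (mu (U i)))^-1 * \1_(U i) x.

Definition sharp (Y : nspace R X) : nspace R I :=
  NSpace [set a : I -> R[i] | nmem Y (fun x => (sharp_fun a x)%:C%C)]
         (fun a => nnorm Y (fun x => (sharp_fun a x)%:C%C)).

Definition finite_sequences_dense (S : nspace R I) : Prop :=
  forall a : I -> R[i], nmem S a -> forall e : R, 0 < e ->
    exists b : I -> R[i],
      [/\ finite_set [set i | b i != 0], nmem S b &
          nnorm S (fun i => a i - b i) < e].

Definition star (x : X) : set X := \bigcup_(i in [set i | U i x]) U i.

Definition osc_kernel (H : completeNormedModType R[i])
    (dot : {dot H for @Num.conj R[i]}) (phi psi : X -> H)
    (x y : X) : R[i] :=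
  (sup [set rnorm (dot (phi y) (psi z)) | z in star x])%:C%C.

End coverings.

(* Main.v *)
Require Import Defs.
From HB Require Import structures.
From mathcomp Require Import all_boot all_order all_algebra finmap sesquilinear.
From mathcomp Require Import complex.
From mathcomp Require Import all_classical all_reals all_analysis ess_sup_inf.
From mathcomp Require Import measurable_realfun ring lra.
From mathcomp.analysis.showcase Require Import summability.

Set Implicit Arguments.
Unset Strict Implicit.
Unset Printing Implicit Defensive.

Import Order.TTheory GRing.Theory Num.Theory.
Import numFieldNormedType.Exports.

Local Open Scope classical_set_scope.
Local Open Scope ring_scope.

(** Write [V f] for the voice transform [x |-> f (phi x)], [t r i] for the analysis
    atom [psi r (xi i)] and [u r i] for the synthesis atom [psit r (xi i)].

    Both oscillation kernels give the same two estimates for sampled atoms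
    (predicate [sampled]): the [H1v] norm of [t r i] is at most a constant times
    [v (xi i)], and the sums over [i] of [v (xi i)] times the integral of
    [h * |V (t r i)|] are at most a constant times the integral of [h * v], for
    every [h >= 0].  The second one ([sampled_sum_le]) is the main estimate: on
    [U i] the kernel dominates [|V (t r i)|], so averaging over [U i] and the
    finite overlap of the covering reduce it to a weighted Schur test.  With
    [h = |V g|] it bounds the sum of [|<g, t r i>| v (xi i)] by the [H1v] norm of
    [g]; with [h = 1_F / v] and [F] of finite measure it shows that only countably
    many atoms are nonzero, which makes the sums over the possibly uncountable
    index set measurable.

    Taking inner products in the expansion of vectors shows that
    [g = sum_r sum_i <g, u r i> t r i] weakly for every [g].  For [g] in [H1v] the
    [H1v] norms of the terms are summable by the two estimates, so the series
    converges to [g] in [H1v] ([dual_expansion_H1v]).  A bounded antilinear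
    functional [f] may therefore be applied term by term, and
    [f = sum_r sum_i f (t r i) u r i] in the weak-star sense
    ([antidual_expansion]).

    The Parseval identity of the tight frame gives
    [|<f, g>| <= int |V f| |V g|] for vectors; applied to the partial sums of the
    expansion, it passes to bounded functionals [f] and [g] in [H1v] by dominated
    convergence ([antidual_le_voice]).  With [g = t r i] this dominates the
    coefficients over [U i] by the kernel operator applied to [|V f|], an element
    of [Y] when [f] is in the coorbit space; this bounds the sequence norm
    ([analysis_bound]).  Conversely, the voice transform of a synthesized
    functional is dominated by the transposed kernel operator applied to the step
    function that defines the sequence norm ([synthesis_bound]).  These two bounds
    yield the characterization and the norm equivalence, and the second one,
    applied to the tails of the coefficient sequence, yields norm convergence when
    the finite sequences are dense. *)

(** * Moduli of complex numbers and measurability *)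

Section modulus.
Context {R : realType}.
Implicit Types (z w : R[i]) (V : normedZmodType R[i]).

Lemma rnormE V (x : V) : (rnorm x)%:C%C = `|x|.
Proof. by rewrite /rnorm RRe_real // ger0_real. Qed.

Lemma rnorm_ge0 V (x : V) : 0 <= rnorm x.
Proof. by rewrite -ler0c rnormE. Qed.

Lemma rnorm0 V : rnorm (0 : V) = 0.
Proof. by apply: complexI; rewrite rnormE normr0. Qed.

Lemma rnorm0_eq0 V (x : V) : rnorm x = 0 -> x = 0.
Proof. by move=> x0; apply/normr0_eq0; rewrite -rnormE x0. Qed.

Lemma ler_rnormD V (x y : V) : rnorm (x + y) <= rnorm x + rnorm y.
Proof. by rewrite -lecR rmorphD /= !rnormE ler_normD. Qed.

Lemma rnormN V (x : V) : rnorm (- x) = rnorm x.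
Proof. by rewrite /rnorm normrN. Qed.

Lemma rnormB V (x y : V) : rnorm (x - y) = rnorm (y - x).
Proof. by rewrite /rnorm distrC. Qed.

Lemma ler_rnormB V (x y : V) : rnorm x <= rnorm y + rnorm (x - y).
Proof. by rewrite -{1}(subrK y x) addrC ler_rnormD. Qed.

Lemma rnormM z w : rnorm (z * w) = rnorm z * rnorm w.
Proof. by apply: complexI; rewrite rmorphM /= !rnormE -normrM. Qed.

Lemma rnormZ (V : normedModType R[i]) z (x : V) : rnorm (z *: x) = rnorm z * rnorm x.
Proof. by apply: complexI; rewrite rmorphM /= !rnormE normrZ. Qed.

Lemma rnorm_conj z : rnorm (z^*) = rnorm z.
Proof. by rewrite /rnorm norm_conjC. Qed.

Lemma rnorm_real (r : R) : 0 <= r -> rnorm (r%:C%C) = r.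
Proof. by move=> r0; rewrite /rnorm ger0_norm// ler0c. Qed.

Lemma rnorm_sqr z : rnorm z ^+ 2 = complex.Re z ^+ 2 + complex.Im z ^+ 2.
Proof.
by apply: complexI; rewrite rmorphXn/= rnormE add_Re2_Im2.
Qed.

Lemma ler_Re_rnorm z : complex.Re z <= rnorm z.
Proof.
have [z0|/ltW z0] := leP (complex.Re z) 0; first exact: le_trans z0 (rnorm_ge0 z).
rewrite -ler_sqr ?nnegrE ?rnorm_ge0// rnorm_sqr lerDl sqr_ge0//.
Qed.

Lemma ler_rnorm_ReIm z : rnorm z <= `|complex.Re z| + `|complex.Im z|.
Proof.
rewrite -ler_sqr ?nnegrE ?rnorm_ge0 ?addr_ge0//.
rewrite rnorm_sqr sqrrD !real_normK ?num_real//.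
by rewrite -addrA [_ *+ _ + _]addrC addrA lerDl mulrn_wge0// mulr_ge0.
Qed.

Lemma normr_Re_le z : `|complex.Re z| <= rnorm z.
Proof.
rewrite -ler_sqr ?nnegrE ?rnorm_ge0// real_normK ?num_real//.
by rewrite rnorm_sqr lerDl sqr_ge0.
Qed.

Lemma normr_Im_le z : `|complex.Im z| <= rnorm z.
Proof.
rewrite -ler_sqr ?nnegrE ?rnorm_ge0// real_normK ?num_real//.
by rewrite rnorm_sqr lerDr sqr_ge0.
Qed.

Lemma ler_rnorm_sum V (J : Type) (s : seq J) (P : pred J) (F : J -> V) :
  rnorm (\sum_(j <- s | P j) F j) <= \sum_(j <- s | P j) rnorm (F j).
Proof.
elim/big_ind2: _ => [|x a y b xa yb|//]; first by rewrite rnorm0.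
by apply: le_trans (ler_rnormD _ _) _; apply: lerD.
Qed.

(** Reduces estimates of the modulus of an inner product to estimates of its real
    part. *)
Lemma rotate_to_rnorm z : exists2 c : R[i], rnorm c = 1 & c * z = (rnorm z)%:C%C.
Proof.
have [->|z0] := eqVneq z 0.
  by exists 1; [rewrite /rnorm normr1|rewrite mulr0 rnorm0].
exists (`|z| / z); last by rewrite mulfVK// rnormE.
by rewrite /rnorm normrM normfV normr_id divff// normr_eq0.
Qed.

End modulus.

Section measurability_pointwise.
Context {R : realType} {d : measure_display} {T : measurableType d}.
Implicit Types f g : T -> R.

Lemma measurable_fun_addr f g : measurable_fun setT f -> measurable_fun setT g ->
  measurable_fun setT (fun x => f x + g x).
Proof. exact: measurable_funD. Qed.

Lemma measurable_fun_subr f g : measurable_fun setT f -> measurable_fun setT g ->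
  measurable_fun setT (fun x => f x - g x).
Proof. exact: measurable_funB. Qed.

Lemma measurable_fun_mulr f g : measurable_fun setT f -> measurable_fun setT g ->
  measurable_fun setT (fun x => f x * g x).
Proof. exact: measurable_funM. Qed.

End measurability_pointwise.

Section complex_measurability.
Context {R : realType} {d : measure_display} {T : measurableType d}.
Implicit Types F G : T -> R[i].

Lemma cmeasurable_rnorm F : cmeasurable F -> measurable_fun setT (fun x => rnorm (F x)).
Proof.
move=> [mR mI].
have -> : (fun x => rnorm (F x)) =
    (fun x => Num.sqrt (complex.Re (F x) ^+ 2 + complex.Im (F x) ^+ 2)).
  by apply/funext => x; rewrite -rnorm_sqr sqrtr_sqr ger0_norm// rnorm_ge0.
apply: (@measurableT_comp _ _ _ _ _ _ (@Num.sqrt R)); first exact: continuous_measurable_fun (@sqrt_continuous R).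
by apply: measurable_fun_addr; apply: measurable_funX.
Qed.

Lemma cmeasurable0 : cmeasurable (fun _ : T => 0 : R[i]).
Proof. by split; exact: measurable_cst. Qed.

Lemma cmeasurableD F G : cmeasurable F -> cmeasurable G -> cmeasurable (fun x => F x + G x).
Proof.
move=> [FR FI] [GR GI]; split.
  rewrite (_ : (fun _ => _) = (fun x => complex.Re (F x) + complex.Re (G x))); last first.
    by apply/funext => x; rewrite raddfD.
  exact: measurable_fun_addr.
rewrite (_ : (fun _ => _) = (fun x => complex.Im (F x) + complex.Im (G x))); last first.
  by apply/funext => x; rewrite raddfD.
exact: measurable_fun_addr.
Qed.

Lemma cmeasurableM F G : cmeasurable F -> cmeasurable G -> cmeasurable (fun x => F x * G x).
Proof.
move=> [FR FI] [GR GI]; split.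
  rewrite (_ : (fun _ => _) = (fun x => complex.Re (F x) * complex.Re (G x)
      - complex.Im (F x) * complex.Im (G x))); last first.
    by apply/funext => x; case: (F x) (G x) => a b [].
  by apply: measurable_fun_subr; apply: measurable_fun_mulr.
rewrite (_ : (fun _ => _) = (fun x => complex.Re (F x) * complex.Im (G x)
      + complex.Im (F x) * complex.Re (G x))); last first.
  by apply/funext => x; case: (F x) (G x) => a b [c e] /=.
by apply: measurable_fun_addr; apply: measurable_fun_mulr.
Qed.

Lemma cmeasurable_cst (z : R[i]) : cmeasurable (fun _ : T => z : R[i]).
Proof. by split; exact: measurable_cst. Qed.

Lemma cmeasurable_real (f : T -> R) : measurable_fun setT f ->
  cmeasurable (fun x => (f x)%:C%C).
Proof. by move=> mf; split => //; exact: measurable_cst. Qed.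

Lemma cmeasurable_sum (J : Type) (s : seq J) (F : J -> T -> R[i]) :
  (forall j, cmeasurable (F j)) -> cmeasurable (fun x => \sum_(j <- s) F j x).
Proof.
move=> mF; elim: s => [|j s ih].
  rewrite (_ : (fun _ => _) = (fun=> 0)); first exact: cmeasurable0.
  by apply/funext => x; rewrite big_nil.
rewrite (_ : (fun _ => _) = (fun x => F j x + \sum_(i <- s) F i x)).
  exact: cmeasurableD.
by apply/funext => x; rewrite big_cons.
Qed.

(** Stated through the moduli of the differences, the form in which the
    convergence of unconditional sums is expressed below. *)
Lemma cmeasurable_limit (u : nat -> T -> R[i]) F :
  (forall k, cmeasurable (u k)) ->
  (forall x, (fun k => rnorm (u k x - F x)) @ \oo --> (0 : R)) ->
  cmeasurable F.
Proof.
move=> mu uF; split.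
  apply: (@measurable_fun_cvg _ _ _ _ (fun k x => complex.Re (u k x))) => [k|x _].
    by have [] := mu k.
  apply/cvgrPdist_lt => e e0; move/cvgrPdist_lt: (uF x) => /(_ e e0); apply: filterS => k.
  rewrite sub0r normrN ger0_norm ?rnorm_ge0//; apply: le_lt_trans.
  by rewrite rnormB -raddfB normr_Re_le.
apply: (@measurable_fun_cvg _ _ _ _ (fun k x => complex.Im (u k x))) => [k|x _].
  by have [] := mu k.
apply/cvgrPdist_lt => e e0; move/cvgrPdist_lt: (uF x) => /(_ e e0); apply: filterS => k.
rewrite sub0r normrN ger0_norm ?rnorm_ge0//; apply: le_lt_trans.
by rewrite rnormB -raddfB normr_Im_le.
Qed.

End complex_measurability.

(** * The theorems of Tonelli and Fatou *)

Section restriction.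
Context {d : measure_display} {T : measurableType d} {R : realType}.
Variables (mu : {measure set T -> \bar R}) (D : set T).
Hypotheses (mD : measurable D) (sD : sigma_finite D mu).

(** The proof of sigma-finiteness is an argument so that the instance of
    sigma-finite measure below can depend on it. *)
Definition restr_sigma_finite of sigma_finite D mu := mrestr mu mD.

Local Notation nu := (restr_sigma_finite sD).

HB.instance Definition _ := Measure.on nu.

Let sigma_finite_restr : sigma_finite setT nu.
Proof.
have [F DF mF] := sD.
exists (fun k => if k is j.+1 then F j else ~` D).
  rewrite -(setvU D) setUC {1}DF eqEsubset; split => x.
    by move=> [[k _ Fx]|Dx]; [exists k.+1|exists 0%N].
  move=> [[|k] _ Fx]; first by right.
  by left; exists k.
move=> [|k]; rewrite /restr_sigma_finite /mrestr.
  by split; [exact: measurableC|rewrite setICl measure0 ltry].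
have [mFk Fkoo] := mF k; split => //.
by rewrite (le_lt_trans _ Fkoo)// le_measure ?inE//; exact: measurableI.
Qed.

HB.instance Definition _ := Measure_isSigmaFinite.Build _ _ _ nu sigma_finite_restr.

Lemma integral_restr (f : T -> \bar R) : measurable_fun setT f ->
  (forall x, 0 <= f x)%E ->
  (\int[nu]_x f x = \int[mu]_(x in D) f x)%E.
Proof.
move=> mf f0; have mDC := measurableC mD.
have -> : (\int[mu]_(x in D) f x = \int[nu]_(x in D) f x)%E.
  apply: eq_measure_integral => A mA AD.
  by rewrite /= /restr_sigma_finite /mrestr /= setIidl.
rewrite (@ge0_negligible_integral _ _ _ _ _ (~` D))//.
- by rewrite setTD setCK.
- by rewrite /= /restr_sigma_finite /mrestr setICl measure0.
Qed.

End restriction.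

Section tonelli.
Context {d1 d2 : measure_display} {T1 : measurableType d1} {T2 : measurableType d2}.
Context {R : realType}.
Variables (m2 : {measure set T2 -> \bar R}) (B : set T2).
Variable f : T1 * T2 -> \bar R.
Hypotheses (mf : measurable_fun setT f) (f0 : forall z, (0 <= f z)%E).

Lemma measurable_section1 x : measurable_fun setT (fun y => f (x, y)).
Proof. exact: measurableT_comp mf (measurable_pair1 x). Qed.

Lemma measurable_section2 y : measurable_fun setT (fun x => f (x, y)).
Proof. exact: measurableT_comp mf (measurable_pair2 y). Qed.

Lemma measurable_partial_integral : measurable B -> sigma_finite B m2 ->
  measurable_fun setT (fun x => \int[m2]_(y in B) f (x, y))%E.
Proof.
move=> mB sB.
have := @measurable_fun_fubini_tonelli_F _ _ T1 T2 R (restr_sigma_finite mB sB) f mf f0.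
apply: eq_measurable_fun => x _; rewrite /fubini_F integral_restr//.
exact: measurable_section1.
Qed.

End tonelli.

(** The measures are arbitrary, but the integrands below live on sigma-finite sets;
    the theorem for sigma-finite measures applies to the restrictions. *)
Lemma tonelli_sigma_finite {d1 d2 : measure_display} {T1 : measurableType d1}
    {T2 : measurableType d2} {R : realType}
    (m1 : {measure set T1 -> \bar R}) (m2 : {measure set T2 -> \bar R})
    (A : set T1) (B : set T2) (f : T1 * T2 -> \bar R) :
  measurable_fun setT f -> (forall z, (0 <= f z)%E) ->
  measurable A -> sigma_finite A m1 -> measurable B -> sigma_finite B m2 ->
  (\int[m1]_(x in A) \int[m2]_(y in B) f (x, y) =
   \int[m2]_(y in B) \int[m1]_(x in A) f (x, y))%E.
Proof.
move=> mf f0 mA sA mB sB.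
have := @fubini_tonelli _ _ T1 T2 R (restr_sigma_finite mA sA) (restr_sigma_finite mB sB) f mf f0.
rewrite integral_restr//; last 2 first.
- exact: measurable_fun_fubini_tonelli_F.
- by move=> x; apply: integral_ge0 => y _; exact: f0.
rewrite integral_restr//; last 2 first.
- exact: measurable_fun_fubini_tonelli_G.
- by move=> x; apply: integral_ge0 => y _; exact: f0.
move=> fubini; transitivity (\int[m1]_(x in A) \int[restr_sigma_finite mB sB]_y f (x, y))%E.
  by apply: eq_integral => x _; rewrite integral_restr//; exact: measurable_section1.
rewrite fubini; apply: eq_integral => y _; rewrite integral_restr//.
exact: measurable_section2.
Qed.

Lemma sigma_finite_finite_measure {d : measure_display} {T : measurableType d}
    {R : realType} (mu : {measure set T -> \bar R}) (D : set T) :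
  measurable D -> (mu D < +oo)%E -> sigma_finite D mu.
Proof.
move=> mD Doo; exists (fun=> D) => //.
by apply/seteqP; split => [x Dx|x [_ _ //]]; exists 0%N.
Qed.

Lemma fatou_bound {d : measure_display} {T : measurableType d} {R : realType}
    (mu : {measure set T -> \bar R}) (f_ : nat -> T -> \bar R) (f : T -> \bar R) (M : \bar R) :
  (forall k, measurable_fun setT (f_ k)) -> (forall k x, (0 <= f_ k x)%E) ->
  (forall x, f_ ^~ x @ \oo --> f x) -> (forall k, (\int[mu]_x f_ k x <= M)%E) ->
  (\int[mu]_x f x <= M)%E.
Proof.
move=> mf f0 cf intM.
have -> : (\int[mu]_x f x = \int[mu]_x limn_einf (f_ ^~ x))%E.
  by apply: eq_integral => x _; rewrite (cvg_limn_einf_sup (cf x)).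
apply: (le_trans (fatou mu measurableT mf (fun k x _ => f0 k x))).
rewrite limn_einf_lim; apply: lime_le; first exact: is_cvg_einfs.
apply: nearW => k; apply: le_trans (intM k); apply: ereal_inf_lbound.
by exists k => //; exact: leqnn.
Qed.

(** * Inner products *)

Section hilbert.
Context {R : realType} {H : completeNormedModType R[i]}.
Variable dot : {dot H for @Num.conj R[i]}.
Hypothesis hH : separable_hilbert dot.

Lemma dotC (f g : H) : dot g f = (dot f g)^*.
Proof. by rewrite hermC expr0 mul1r. Qed.

Lemma rnorm_dotC (f g : H) : rnorm (dot g f) = rnorm (dot f g).
Proof. by rewrite dotC rnorm_conj. Qed.

Lemma rnorm_sqr_dot (f : H) : rnorm f ^+ 2 = complex.Re (dot f f).
Proof.
have [/(_ f) <- _] := hH.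
by rewrite -rnormE -rmorphXn.
Qed.

Lemma rnorm_sqrD (f g : H) :
  rnorm (f + g) ^+ 2 = rnorm f ^+ 2 + rnorm g ^+ 2 + 2 * complex.Re (dot f g).
Proof.
rewrite !rnorm_sqr_dot linearDl/= !linearDr/= (dotC f g) !raddfD/=.
have -> : complex.Re (dot f g)^* = complex.Re (dot f g) by case: (dot f g).
ring.
Qed.

Lemma rnorm_sqrB (f g : H) :
  rnorm (f - g) ^+ 2 = rnorm f ^+ 2 + rnorm g ^+ 2 - 2 * complex.Re (dot f g).
Proof. by rewrite rnorm_sqrD rnormN linearNr raddfN mulrN. Qed.

Lemma rnorm_dot_le (f g : H) : 2 * rnorm (dot f g) <= rnorm f ^+ 2 + rnorm g ^+ 2.
Proof.
have [c c1 cE] := rotate_to_rnorm (dot f g).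
have := sqr_ge0 (rnorm (c *: f - g)).
by rewrite rnorm_sqrB linearZl_LR/= cE/= rnormZ c1 mul1r subr_ge0.
Qed.

Lemma rnorm_dot_CS (f g : H) : rnorm (dot f g) <= rnorm f * rnorm g.
Proof.
have [->|f0] := eqVneq f 0; first by rewrite linear0l !rnorm0 mul0r.
have [->|g0] := eqVneq g 0; first by rewrite linear0r !rnorm0 mulr0.
have pos (h : H) : h != 0 -> 0 < rnorm h.
  by move=> h0; rewrite lt_neqAle rnorm_ge0 andbT eq_sym; apply: contra_neq h0 => /rnorm0_eq0.
have := rnorm_dot_le ((rnorm f)^-1%:C%C *: f) ((rnorm g)^-1%:C%C *: g).
rewrite linearZl_LR linearZr_LR/= !rnormM !rnormZ rnorm_conj.
rewrite !rnorm_real ?invr_ge0 ?rnorm_ge0// !mulVf ?gt_eqF ?pos// expr1n.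
set t := (_ * _ in X in X <= _) => ht.
have -> : rnorm (dot f g) = rnorm f * rnorm g * ((rnorm f)^-1 * ((rnorm g)^-1 * rnorm (dot f g))).
  by field; rewrite !gt_eqF ?pos.
by apply: ler_piMr; [rewrite mulr_ge0// rnorm_ge0|move: ht; rewrite /t; lra].
Qed.

End hilbert.

(** * The voice transform of a tight frame *)

Section tight_frame.
Context {R : realType} {X : ptopologicalType} {H : completeNormedModType R[i]}.
Variable mu : {measure set (borel X) -> \bar R}.
Variable dot : {dot H for @Num.conj R[i]}.
Hypothesis hH : separable_hilbert dot.
Variable phi : X -> H.
Hypothesis hphi : tight_frame mu dot phi.

Lemma measurable_voice (f : H) :
  measurable_fun setT (fun y : borel X => rnorm (dot f (phi y))).
Proof. by have [mf _ _] := hphi; apply: cmeasurable_rnorm. Qed.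

(** Polarization, with the cross term estimated by the product of the moduli. *)
Lemma voice_sqrD (f g : H) y :
  rnorm (dot (f + g) (phi y)) ^+ 2 <=
  rnorm (dot (f - g) (phi y)) ^+ 2 + 4 * (rnorm (dot f (phi y)) * rnorm (dot g (phi y))).
Proof.
rewrite linearDl linearBl/=; set a := dot f _; set b := dot g _.
have := ler_Re_rnorm (a * b^*); rewrite rnormM rnorm_conj => ab.
suff -> : rnorm (a + b) ^+ 2 = rnorm (a - b) ^+ 2 + 4 * complex.Re (a * b^*).
  by rewrite lerD2l ler_pM2l.
by rewrite !rnorm_sqr; case: (a) (b) => p q [r s] /=; ring.
Qed.

(** The Parseval identity of a tight frame, in the form of an inequality obtained
    by integrating the polarization estimate; only moduli occur, so that no complex
    integral is involved. *)
Lemma rnorm_dot_le_voice (f g : H) :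
  ((rnorm (dot f g))%:E <=
   \int[mu]_y (rnorm (dot f (phi y)) * rnorm (dot g (phi y)))%:E)%E.
Proof.
(* Rotate [f] so that the inner product becomes nonnegative. *)
wlog [c0 cE] : f / 0 <= rnorm (dot f g) /\ dot f g = (rnorm (dot f g))%:C%C.
  move=> wl; have [c c1 cE] := rotate_to_rnorm (dot f g).
  have cf h : rnorm (dot (c *: f) h) = rnorm (dot f h) by rewrite linearZl_LR/= rnormM c1 mul1r.
  have := wl (c *: f); rewrite cf linearZl_LR/= cE; under eq_integral do rewrite cf.
  by apply; split; rewrite ?rnorm_ge0.
set J := (\int[mu]_y _)%E.
have J0 : (0 <= J)%E by apply: integral_ge0 => y _; rewrite lee_fin mulr_ge0// rnorm_ge0.
have [mphi _ bounds] := hphi.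
have [lo _] := bounds (f + g); have [_ up] := bounds (f - g).
have : ((rnorm (f + g) ^+ 2)%:E <= (rnorm (f - g) ^+ 2)%:E + 4%:E * J)%E.
  rewrite mul1r in lo; rewrite mul1r in up.
  apply: (le_trans lo); apply: (@le_trans _ _
    (\int[mu]_y (rnorm (dot (f - g) (phi y)) ^+ 2)%:E + 4%:E * J)%E); last by rewrite leeD2r.
  have mV h : measurable_fun setT (fun y : borel X => (rnorm (dot h (phi y)) ^+ 2)%:E).
    by apply/measurable_EFinP; apply: measurable_funX; exact: measurable_voice.
  have mP : measurable_fun setT
      (fun y : borel X => (rnorm (dot f (phi y)) * rnorm (dot g (phi y)))%:E).
    by apply/measurable_EFinP; apply: measurable_fun_mulr; exact: measurable_voice.
  rewrite /J -ge0_integralZl_EFin//; last first.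
    by move=> y _; rewrite lee_fin mulr_ge0// rnorm_ge0.
  rewrite -ge0_integralD//; last 3 first.
  - by move=> y _; rewrite lee_fin sqr_ge0.
  - by move=> y _; rewrite -EFinM lee_fin mulr_ge0// mulr_ge0 ?rnorm_ge0.
  - exact: measurable_funeM.
  apply: ge0_le_integral => //.
  - by move=> y _; rewrite lee_fin sqr_ge0.
  - by apply: emeasurable_funD => //; exact: measurable_funeM.
  - by move=> y _; rewrite -EFinM -EFinD lee_fin voice_sqrD.
have re : complex.Re (dot f g) = rnorm (dot f g) by rewrite {1}cE.
rewrite (rnorm_sqrD hH) (rnorm_sqrB hH) re.
case: J J0 => [r _|_|//]; last by rewrite leey.
by rewrite -EFinM -EFinD !lee_fin; lra.
Qed.

End tight_frame.

(** * Countable index sets *)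

Lemma countable_enumeration (T : choiceType) (A : set T) : countable A -> A !=set0 ->
  exists u : nat -> T, range u = A.
Proof.
move=> /countable_injP[f injf] [x0 Ax0].
exists (fun k => xget x0 [set x | A x /\ f x = k]); apply/seteqP; split => [_ [k _ <-]|x Ax].
  by case: xgetP => [x _ []|].
exists (f x) => //; case: xgetP => [y _ [Ay fy]|/(_ x)[]//].
by apply: injf; rewrite ?inE.
Qed.

(** Turns unconditional sums over an arbitrary index set into limits of sequences,
    to which the convergence theorems for integrals apply. *)
Lemma countable_exhaustion (I : choiceType) (A : set I) : countable A ->
  exists2 J : nat -> {fset I}, (forall k i, i \in J k -> A i) &
    forall B : {fset I}, (forall i, i \in B -> A i) ->
      \forall k \near \oo, {subset B <= J k}.
Proof.
move=> cA; have [A0|A0] := pselect (A !=set0); last first.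
  exists (fun=> fset0) => [k i|B BA]; first by rewrite inE.
  by apply: nearW => k i /BA Ai; case: A0; exists i.
have [u uA] := countable_enumeration cA A0.
exists (fun k => seq_fset tt [seq u n | n <- iota 0 k]) => [k i|B BA].
  by rewrite seq_fsetE => /mapP[n _ ->]; rewrite -uA; exists n.
have [g gE] : exists g : I -> nat, forall i, A i -> u (g i) = i.
  have /choice[g gE] : forall i, exists n, A i -> u n = i.
    move=> i; have [|nA] := pselect (A i); last by exists 0%N.
    by rewrite -uA => -[n _ <-]; exists n.
  by exists g.
exists (\max_(i <- B) g i).+1 => // k kB i iB; rewrite seq_fsetE.
apply/mapP; exists (g i); last by rewrite gE//; exact: BA.
by rewrite mem_iota add0n /= (leq_ltn_trans _ kB)//; exact: leq_bigmax_seq.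
Qed.

(** * The support of a frame *)

Section support.
Context {R : realType} {X : ptopologicalType} {H : completeNormedModType R[i]}.
Variable mu : {measure set (borel X) -> \bar R}.
Variable dot : {dot H for @Num.conj R[i]}.
Hypothesis hH : separable_hilbert dot.
Variable phi : X -> H.
Hypothesis hphi : tight_frame mu dot phi.

Definition frame_support : set (borel X) := [set y | phi y != 0].

(** By Pythagoras, a vector orthogonal to [h] is no closer to [h] than the origin. *)
Lemma dense_dot_neq0 (D : set H) (h : H) : dense D -> h != 0 ->
  exists2 f, D f & dot f h != 0.
Proof.
move=> dD h0; have hpos : 0 < `|h| by rewrite normr_gt0.
have op : open (ball h `|h|) by exact: ball_open.
have [f [hf Df]] := dD (ball h `|h|) (ex_intro _ h (ballxx h hpos)) op.
exists f => //; apply/eqP => fh0; move: hf; rewrite -ball_normE/= -!rnormE ltcR.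
apply/negP; rewrite -leNgt -ler_sqr ?nnegrE ?rnorm_ge0// (rnorm_sqrB hH).
by rewrite (dotC dot f h) fh0 conjC0 mulr0 subr0 lerDl sqr_ge0.
Qed.

Let superlevel (f : H) (l : nat) : set (borel X) :=
  [set y | l.+1%:R^-1 <= rnorm (dot f (phi y)) ^+ 2].

Let measurable_superlevel f l : measurable (superlevel f l).
Proof.
rewrite -[superlevel f l]setTI; apply: measurable_fun_ler => //.
exact: measurable_funX (measurable_voice hphi f).
Qed.

Let superlevel_finite f l : (mu (superlevel f l) < +oo)%E.
Proof.
have [_ _ /(_ f)[_ up]] := hphi.
have := @le_integral_abse _ _ _ mu setT measurableT
  (fun y => (rnorm (dot f (phi y)) ^+ 2)%:E) (l.+1%:R^-1).
have abs y : `|(rnorm (dot f (phi y)) ^+ 2)%:E|%E = (rnorm (dot f (phi y)) ^+ 2)%:E.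
  by rewrite abse_EFin ger0_norm ?sqr_ge0.
under eq_set do rewrite abs lee_fin; rewrite setTI; under eq_integral do rewrite abs.
move=> /(_ _ _)/le_lt_trans => markov.
have : (l.+1%:R^-1%:E * mu (superlevel f l) < +oo)%E.
  apply: markov; last by apply: le_lt_trans up _; rewrite ltry.
  - by apply/measurable_EFinP/measurable_funX; exact: measurable_voice hphi f.
  - by rewrite invr_gt0.
case: (mu _) => [r _||//]; first by rewrite ltry.
by rewrite gt0_muley ?lte_fin ?invr_gt0.
Qed.

(** The sets are superlevel sets of the integrable functions [|<f, phi y>|^2], where
    [f] runs through a countable dense set; they have finite measure by Markov's
    inequality. *)
Lemma frame_support_bigcup : exists F : nat -> set (borel X),
  frame_support = \bigcup_k F k /\
  forall k, measurable (F k) /\ (mu (F k) < +oo)%E.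
Proof.
have [_ [D [cD dD]]] := hH.
have [|u uD] := countable_enumeration cD.
  have [f [_ Df]] := dD setT (ex_intro _ (0 : H) I) openT.
  by exists f.
exists (fun k => if @choice.unpickle (nat * nat)%type k is Some p then superlevel (u p.1) p.2 else set0).
split; last by move=> k; case: choice.unpickle => [p|]; [split|rewrite measure0 ltry].
apply/seteqP; split => [y /= y0|y [k _]]; last first.
  case: choice.unpickle => // -[m l]/=; apply: contraTN => /eqP ->.
  by rewrite /= linear0r rnorm0 expr0n/= -ltNge invr_gt0.
have [f] := dense_dot_neq0 dD y0; rewrite -uD => -[m _ <-] fy.
have pos : 0 < rnorm (dot (u m) (phi y)) ^+ 2.
  rewrite exprn_gt0// lt_neqAle rnorm_ge0 andbT eq_sym.
  by apply: contra_neq fy => /rnorm0_eq0.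
have [l] := ltr_add_invr pos; rewrite add0r => /ltW hl.
by exists (choice.pickle (m, l)) => //; rewrite choice.pickleK.
Qed.

Lemma measurable_frame_support : measurable frame_support.
Proof.
have [F [-> hF]] := frame_support_bigcup.
by apply: bigcupT_measurable => k; have [] := hF k.
Qed.

Lemma sigma_finite_frame_support : sigma_finite frame_support mu.
Proof. by have [F [SF hF]] := frame_support_bigcup; exists F. Qed.

End support.

(** * Coverings of finite overlap and the sequence norm *)

Lemma ler_sum_subset {R : realType} {I : choiceType} (s t : seq I) (c : I -> R) :
  uniq s -> uniq t -> {subset s <= t} -> (forall i, 0 <= c i) ->
  \sum_(i <- s) c i <= \sum_(i <- t) c i.
Proof.
move=> us ut st c0; rewrite [leRHS](bigID (mem s))/= -[X in _ <= X + _]big_filter.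
have /(perm_big _)-> : perm_eq [seq i <- t | i \in s] s.
  apply: uniq_perm; rewrite ?filter_uniq// => i.
  by rewrite mem_filter; case: (boolP (i \in s)) => // /st.
by rewrite lerDl sumr_ge0.
Qed.

Lemma closed_borel (X : ptopologicalType) (A : set X) :
  closed A -> measurable (A : set (borel X)).
Proof.
move=> cA; rewrite -[A]setCK; apply: measurableC; apply: sub_sigma_algebra.
exact: closed_openC.
Qed.

Section covering.
Context {R : realType} {X : ptopologicalType} {I : choiceType}.
Variable mu : {measure set (borel X) -> \bar R}.
Variable U : I -> set X.
Hypothesis hU : moderate_covering mu U.
Hypothesis mU : forall i, measurable (U i : set (borel X)).
Hypothesis mufin : forall K : set X, compact K -> (mu K < +oo)%E.
Implicit Types (a b : I -> R[i]) (x : X) (i : I) (J : {fset I}).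

Definition indices_at x : {fset I} := fset_set [set i | U i x].

Lemma overlap_bound : exists N : nat, forall x,
  finite_set [set i | U i x] /\ (#|` indices_at x| <= N)%N.
Proof.
have [[_ _ cov [N hN]] _ _] := hU; exists N => x.
have [j _ Ujx] : (\bigcup_i U i) x by rewrite cov.
have le : ([set i | U i x] #<= `I_N)%card.
  apply: card_le_trans (hN j); apply: subset_card_le => i /= Uix; by exists x.
split; last exact: geq_card_fset_set.
by apply/finite_set_leP; exists N.
Qed.

Lemma in_indices_at x i : i \in indices_at x <-> U i x.
Proof.
have [N /(_ x)[fin _]] := overlap_bound.
by rewrite /indices_at in_fset_set// inE.
Qed.

Lemma mem_star x i z : U i x -> U i z -> star U x z.
Proof. by move=> Uix Uiz; exists i. Qed.

Lemma star_nonempty x : star U x !=set0.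
Proof.
have [[_ _ cov _] _ _] := hU.
have [j _ Ujx] : (\bigcup_i U i) x by rewrite cov.
by exists x; exact: (mem_star Ujx Ujx).
Qed.

Lemma sum_indicE x J (c : I -> R) :
  \sum_(i <- J) c i * \1_(U i) x = \sum_(i <- J | i \in indices_at x) c i.
Proof.
rewrite [RHS]big_mkcond; apply: eq_bigr => i _; rewrite indicE.
case: ifPn => [/in_indices_at Uix|/negP xU]; first by rewrite mem_set// mulr1.
by rewrite memNset ?mulr0// => Uix; apply/xU/in_indices_at.
Qed.

Lemma sum_indic_le x J (c : I -> R) : (forall i, 0 <= c i) ->
  \sum_(i <- J) c i * \1_(U i) x <= \sum_(i <- indices_at x) c i.
Proof.
move=> c0; rewrite sum_indicE -big_filter; apply: ler_sum_subset => //.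
- exact/filter_uniq/fset_uniq.
- by move=> i; rewrite mem_filter => /andP[].
Qed.

Lemma sum_indices_at_le (N : nat) x (c : I -> R) (M : R) :
  (#|` indices_at x| <= N)%N -> 0 <= M -> (forall i, U i x -> c i <= M) ->
  \sum_(i <- indices_at x) c i <= N%:R * M.
Proof.
move=> leN M0 cM; apply: (@le_trans _ _ (\sum_(i <- indices_at x) M)).
  by rewrite !big_seq; apply: ler_sum => i /in_indices_at; exact: cM.
rewrite big_const_seq count_predT iter_addr_0 mulr_natl.
exact: ler_wpMn2l.
Qed.

Lemma cover_measure : exists2 D : R, 0 < D & forall i,
  [/\ mu (U i) = (fine (mu (U i)))%:E, D <= fine (mu (U i)) & 0 < fine (mu (U i))].
Proof.
have [[cpt _ _ _] [D [D0 leD]] _] := hU; exists D => // i.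
have Ufin : (mu (U i) < +oo)%E.
  have := mufin (cpt i); apply: le_lt_trans; apply: le_measure.
  - by rewrite inE; exact: mU.
  - by rewrite inE; apply: closed_borel; exact: closed_closure.
  - exact: subset_closure.
have UE : mu (U i) = (fine (mu (U i)))%:E.
  by rewrite fineK// ge0_fin_numE// measure_ge0.
by split => //; [|apply: lt_le_trans D0 _]; rewrite -lee_fin -UE.
Qed.

Lemma sharp_funE a x : sharp_fun mu U a x =
  \sum_(i <- indices_at x) rnorm (a i) * (fine (mu (U i)))^-1.
Proof.
rewrite /sharp_fun (fsbigTE (indices_at x)) => [|i xi]; last first.
  by rewrite indicE memNset ?mulr0// => /in_indices_at; apply/negP.
rewrite sum_indicE big_seq_cond [RHS]big_seq_cond.
by apply: eq_bigl => i; rewrite andbT andbb.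
Qed.

Lemma sharp_weight_ge0 a i : 0 <= rnorm (a i) * (fine (mu (U i)))^-1.
Proof. by rewrite mulr_ge0 ?rnorm_ge0// invr_ge0 fine_ge0. Qed.

Lemma sharp_fun_ge0 a x : 0 <= sharp_fun mu U a x.
Proof. by rewrite sharp_funE sumr_ge0// => i _; exact: sharp_weight_ge0. Qed.

Lemma partial_sum_le_sharp_fun a x J :
  \sum_(i <- J) rnorm (a i) * (fine (mu (U i)))^-1 * \1_(U i) x <= sharp_fun mu U a x.
Proof. by rewrite sharp_funE; apply: sum_indic_le => i; exact: sharp_weight_ge0. Qed.

Lemma le_sharp_fun a b x : (forall i, rnorm (a i) <= rnorm (b i)) ->
  sharp_fun mu U a x <= sharp_fun mu U b x.
Proof.
move=> ab; rewrite !sharp_funE; apply: ler_sum => i _.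
by rewrite ler_wpM2r// invr_ge0 fine_ge0.
Qed.

(** The partial sums along an exhaustion of the support are measurable, and at each
    point they eventually equal the full sum, since only finitely many [U i]
    contain the point. *)
Lemma measurable_sharp_fun a : countable [set i | a i != 0] ->
  measurable_fun setT (sharp_fun mu U a : borel X -> R).
Proof.
move=> /countable_exhaustion[J Ja hJ].
apply: (@measurable_fun_cvg _ _ _ _ (fun k (x : borel X) =>
    \sum_(i <- J k) rnorm (a i) * (fine (mu (U i)))^-1 * \1_(U i) x)) => [k|x _].
  apply: measurable_sum => i; apply: measurable_fun_mulr => //.
apply/cvgrPdist_lt => e e0.
have /hJ : forall i, i \in [fset i in indices_at x | a i != 0]%fset -> a i != 0.
  by move=> i; rewrite !inE => /andP[].
apply: filterS => k sub.
suff -> : sharp_fun mu U a x =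
    \sum_(i <- J k) rnorm (a i) * (fine (mu (U i)))^-1 * \1_(U i) x by rewrite subrr normr0.
apply: le_anti; rewrite partial_sum_le_sharp_fun andbT sharp_funE sum_indicE.
rewrite (bigID (fun i => a i != 0))/= [X in _ + X]big1 ?addr0; last first.
  by move=> i /negPn/eqP ->; rewrite rnorm0 mul0r.
rewrite -big_filter -[leRHS]big_filter; apply: ler_sum_subset.
- exact/filter_uniq/fset_uniq.
- exact/filter_uniq/fset_uniq.
- move=> i; rewrite !mem_filter => /andP[ai ix]; rewrite ix/=.
  by apply: sub; rewrite !inE ix.
- by move=> i; exact: sharp_weight_ge0.
Qed.

End covering.

(** * Kernels satisfying a weighted Schur condition *)

Section schur.
Context {R : realType} {X : ptopologicalType}.
Variable mu : {measure set (borel X) -> \bar R}.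
Variable v : X -> R.
Hypothesis hv : is_weight v.

Local Notation m := (assoc_weight v).

Lemma weight_ge1 x : 1 <= v x. Proof. by have [_] := hv. Qed.

Lemma weight_gt0 x : 0 < v x. Proof. exact: lt_le_trans ltr01 (weight_ge1 x). Qed.

Lemma weight_ge0 x : 0 <= v x. Proof. exact/ltW/weight_gt0. Qed.

Lemma measurable_weight : measurable_fun setT (v : borel X -> R).
Proof. by have [] := hv. Qed.

Lemma measurable_inv_weight : measurable_fun setT (fun x : borel X => (v x)^-1).
Proof.
rewrite (_ : (fun _ => _) = (fun x => v x `^ (-1))); last first.
  by apply/funext => x; rewrite powR_inv1// weight_ge0.
exact: (measurableT_comp (measurable_powR _) measurable_weight).
Qed.

Lemma assoc_weightC x y : m x y = m y x.
Proof. by rewrite /assoc_weight maxC. Qed.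

Lemma le_assoc_weight x y : v x <= m x y * v y.
Proof. by rewrite -ler_pdivrMr ?weight_gt0// le_max lexx. Qed.

Lemma assoc_weight_ge0 x y : 0 <= m x y.
Proof. by rewrite le_max divr_ge0 ?weight_ge0. Qed.

Lemma measurable_assoc_weight :
  measurable_fun setT (fun z : borel X * borel X => m z.1 z.2).
Proof.
have m1 : measurable_fun setT (fun z : borel X * borel X => v z.1).
  exact: (measurableT_comp measurable_weight measurable_fst).
have m2 : measurable_fun setT (fun z : borel X * borel X => v z.2).
  exact: (measurableT_comp measurable_weight measurable_snd).
by apply: measurable_maxr; apply: measurable_fun_mulr => //;
  [exact: (measurableT_comp measurable_inv_weight measurable_snd)
  |exact: (measurableT_comp measurable_inv_weight measurable_fst)].
Qed.

(** Membership in [A_m] for a nonnegative real kernel, with an explicit bound in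
    place of the essential suprema. *)
Record schur_bounded (A : R) (K : X -> X -> R) : Prop := SchurBounded {
  schur_const_ge0 : 0 <= A ;
  schur_ge0 : forall x y, 0 <= K x y ;
  schur_measurable : measurable_fun setT (fun z : borel X * borel X => K z.1 z.2) ;
  schur_row : {ae mu, forall x : borel X, (\int[mu]_y (K x y * m x y)%:E <= A%:E)%E} ;
  schur_col : {ae mu, forall y : borel X, (\int[mu]_x (K x y * m x y)%:E <= A%:E)%E} }.

Lemma schur_transpose A K : schur_bounded A K -> schur_bounded A (fun x y => K y x).
Proof.
move=> [A0 K0 mK row col]; split => //.
- exact: (measurableT_comp mK (@measurable_swap _ _ (borel X) (borel X))).
- apply: filterS col => x; rewrite (_ : (fun y => (K y x * m x y)%:E) = (fun y => (K y x * m y x)%:E))//.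
  by apply/funext => y; rewrite assoc_weightC.
- apply: filterS row => x; rewrite (_ : (fun y => (K x y * m y x)%:E) = (fun y => (K x y * m x y)%:E))//.
  by apply/funext => y; rewrite assoc_weightC.
Qed.

Lemma Am_schur (K : X -> X -> R[i]) : Am mu m K ->
  exists A, schur_bounded A (fun x y => rnorm (K x y)).
Proof.
move=> [mK fin]; exists (Num.max (fine (Am_norm mu m K)) 0).
have le : (Am_norm mu m K <= (Num.max (fine (Am_norm mu m K)) 0)%:E)%E.
  case: (Am_norm mu m K) fin => [r _|//|_]; last by rewrite leNye.
  by rewrite lee_fin le_max lexx.
move: le; rewrite /Am_norm ge_max => /andP[/ess_supP row /ess_supP col].
split => //; first by rewrite le_max lexx orbT.
- by move=> x y; exact: rnorm_ge0.
- exact: cmeasurable_rnorm.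
Qed.

Variables (A : R) (K : X -> X -> R).
Hypothesis hK : schur_bounded A K.

Lemma measurable_weighted_kernel :
  measurable_fun setT (fun z : borel X * borel X => (K z.1 z.2 * m z.1 z.2)%:E).
Proof.
apply/measurable_EFinP/measurable_fun_mulr; first exact: schur_measurable hK.
exact: measurable_assoc_weight.
Qed.

(** After exchanging the integrals, the column bound of [K m] absorbs the weight
    because [v x <= m x y * v y].  The exchange needs sigma-finite domains of
    integration, hence the sets [W] and [S]. *)
Lemma schur_test (h : X -> R) (W S : set (borel X)) :
  (forall y, 0 <= h y) -> measurable_fun setT (h : borel X -> R) ->
  measurable W -> sigma_finite W mu -> measurable S -> sigma_finite S mu ->
  (\int[mu]_(x in W) \int[mu]_(y in S) (h y * K x y * v x)%:E <=
   A%:E * \int[mu]_y (h y * v y)%:E)%E.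
Proof.
move=> h0 mh mW sW mS sS.
have K0 := schur_ge0 hK.
have mv := measurable_weight.
pose G (z : borel X * borel X) := (h z.2 * K z.1 z.2 * v z.1)%:E.
have mG : measurable_fun setT G.
  apply/measurable_EFinP; apply: measurable_fun_mulr.
    apply: measurable_fun_mulr; last exact: schur_measurable hK.
    exact: (measurableT_comp mh measurable_snd).
  exact: (measurableT_comp mv measurable_fst).
have G0 z : (0 <= G z)%E by rewrite lee_fin !mulr_ge0// weight_ge0.
have mhv : measurable_fun setT (fun y : borel X => (h y * v y)%:E).
  by apply/measurable_EFinP/measurable_fun_mulr.
have hv0 y : (0 <= (h y * v y)%:E)%E by rewrite lee_fin mulr_ge0// weight_ge0.
rewrite (@tonelli_sigma_finite _ _ _ _ _ mu mu W S G)//.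
have A0 := schur_const_ge0 hK.
rewrite -ge0_integralZl_EFin//.
apply: (@le_trans _ _ (\int[mu]_(y in S) (A%:E * (h y * v y)%:E))%E); last first.
  apply: ge0_subset_integral => //; first exact: measurable_funeM.
  by move=> y _; rewrite mule_ge0// lee_fin.
apply: ae_ge0_le_integral => //.
- by move=> y _; exact: integral_ge0.
- apply: measurable_funTS.
  apply: (@measurable_partial_integral _ _ _ _ _ mu W (fun z => G (z.2, z.1))) => //.
  exact: (measurableT_comp mG (@measurable_swap _ _ (borel X) (borel X))).
- by move=> y _; rewrite mule_ge0// lee_fin.
- by apply: measurable_funTS; exact: measurable_funeM.
apply: filterS (schur_col hK) => y Ay _.
have mKm : measurable_fun setT (fun x : borel X => (K x y * m x y)%:E).
  exact: (measurable_section2 measurable_weighted_kernel).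
have mGy : measurable_fun setT (fun x : borel X => G (x, y)).
  exact: (measurable_section2 mG).
apply: (@le_trans _ _ (\int[mu]_x G (x, y))%E).
  by apply: ge0_subset_integral.
apply: (@le_trans _ _ ((h y * v y)%:E * \int[mu]_x (K x y * m x y)%:E)%E); last first.
  by rewrite muleC lee_wpmul2r.
rewrite -ge0_integralZl_EFin//; last 2 first.
- by move=> x _; rewrite lee_fin mulr_ge0// assoc_weight_ge0.
- by rewrite mulr_ge0// weight_ge0.
apply: ge0_le_integral => //; first exact: measurable_funeM.
move=> x _; rewrite -EFinM lee_fin -!mulrA ler_wpM2l//.
by rewrite mulrCA ler_wpM2l// mulrC le_assoc_weight.
Qed.

End schur.

(** * Unconditional sums *)

#[local] Existing Instance totally_filter.

Section unconditional_sums.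
Context {R : realType} {I : choiceType}.
Implicit Types (J B : {fset I}).

(** Convergence along the directed set of finite subsets, in terms of real
    moduli. *)
Definition has_usum {V : normedZmodType R[i]} (a : I -> V) (s : V) : Prop :=
  forall e : R, 0 < e -> exists B, forall J, {subset B <= J} ->
    rnorm (s - \sum_(i <- J) a i) <= e.

Lemma partial_sumE {V : zmodType} (a : I -> V) J :
  partial_sum a J = \sum_(i <- J) a i.
Proof. by rewrite /partial_sum big_seq_fsetE. Qed.

Lemma has_usum_cvg {V : normedModType R[i]} (a : I -> V) s :
  has_usum a s <-> partial_sum a @ totally --> s.
Proof.
split=> [sa|/cvgrPdist_lt sa e e0].
  apply/cvgrPdist_le => e e0.
  have eE : e = (rnorm e)%:C%C by rewrite rnormE gtr0_norm.
  have /sa[B hB] : 0 < rnorm e by rewrite -ltcR -eE.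
  exists B => // J /fsubsetP/hB; rewrite -lecR rnormE -eE => h.
  by rewrite /= partial_sumE.
have [|B _ hB] := sa (e%:C%C); first by rewrite ltcR.
exists B => J BJ; rewrite -lecR rnormE ltW// -partial_sumE.
by apply: hB; apply/fsubsetP.
Qed.

Lemma has_usum_unique {V : normedZmodType R[i]} (a : I -> V) s t :
  has_usum a s -> has_usum a t -> s = t.
Proof.
move=> sa ta; apply/eqP; rewrite -subr_eq0; apply/eqP/rnorm0_eq0/le_anti.
rewrite rnorm_ge0 andbT; apply/ler_addgt0Pl => e e0; rewrite addr0.
have e2 : 0 < e / 2 by rewrite divr_gt0.
have [B hB] := sa _ e2; have [B' hB'] := ta _ e2.
have BU J J' : {subset J <= (J `|` J')%fset} /\ {subset J' <= (J `|` J')%fset}.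
  by split=> i; rewrite inE => ->; rewrite ?orbT.
have [/hB h1 /hB' h2] := BU B B'.
set p := \sum_(i <- _) _ in h1 h2; rewrite -(subrKA p) [e]splitr.
by apply: le_trans (ler_rnormD _ _) _; rewrite lerD// rnormB.
Qed.

Lemma eq_has_usum {V : normedZmodType R[i]} (a b : I -> V) s :
  a =1 b -> has_usum a s -> has_usum b s.
Proof. by move=> /funext <-. Qed.

Lemma has_usum_finite_sum {V : normedZmodType R[i]} (n : nat) (a : 'I_n -> I -> V)
    (s : 'I_n -> V) : (forall r, has_usum (a r) (s r)) ->
  has_usum (fun i => \sum_r a r i) (\sum_r s r).
Proof.
move=> sa e e0.
have en : 0 < e / n.+1%:R by rewrite divr_gt0.
have /choice[B hB] : forall r, exists B, forall J, {subset B <= J} ->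
    rnorm (s r - \sum_(i <- J) a r i) <= e / n.+1%:R.
  by move=> r; exact: sa.
exists (\bigcup_(r <- enum 'I_n) B r)%fset => J BJ.
rewrite exchange_big/= -sumrB (le_trans (ler_rnorm_sum _ _ _))//.
apply: (@le_trans _ _ (\sum_(r < n) (e / n.+1%:R))).
  apply: ler_sum => r _; apply: hB => i iB; apply: BJ.
  by apply/bigfcupP; exists r => //; rewrite mem_enum.
rewrite sumr_const card_ord -[_ *+ n]mulr_natr -mulrA ler_piMr ?(ltW e0)//.
by rewrite mulrC ler_pdivrMr// mul1r ler_nat.
Qed.

Lemma has_usumD {V : normedZmodType R[i]} (a b : I -> V) s t :
  has_usum a s -> has_usum b t -> has_usum (fun i => a i + b i) (s + t).
Proof.
move=> sa tb.
have := has_usum_finite_sum (n := 2)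
  (a := fun r i => if r == ord0 then a i else b i) (s := fun r => if r == ord0 then s else t).
rewrite !big_ord_recl big_ord0 addr0/= => /(_ _)/eq_has_usum; apply.
  by move=> i; rewrite !big_ord_recl big_ord0 addr0.
by move=> r; case: ifP.
Qed.

Lemma has_usum_fset {V : normedZmodType R[i]} (a : I -> V) J :
  (forall i, i \notin J -> a i = 0) -> has_usum a (\sum_(i <- J) a i).
Proof.
move=> a0 e e0; exists J => B JB.
have -> : \sum_(i <- B) a i = \sum_(i <- J) a i.
  by apply/esym/big_fset_incl => [|i _]; [exact/fsubsetP|exact: a0].
by rewrite subrr rnorm0 ltW.
Qed.

Lemma has_usum_le {V : normedZmodType R[i]} (a : I -> V) s (M : R) : has_usum a s ->
  (forall J, \sum_(i <- J) rnorm (a i) <= M) -> rnorm s <= M.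
Proof.
move=> sa aM; apply/ler_addgt0Pl => e /sa[B hB].
apply: le_trans (ler_rnormB _ (\sum_(i <- B) a i)) _.
rewrite addrC lerD//; first exact: hB.
by apply: le_trans (ler_rnorm_sum _ _ _) (aM B).
Qed.

Lemma has_usumZ (c : R[i]) (a : I -> R[i]) s :
  has_usum a s -> has_usum (fun i => c * a i) (c * s).
Proof.
move=> sa e e0; have d0 : 0 < rnorm c + 1 by rewrite ltr_wpDl// rnorm_ge0.
have [|B hB] := sa (e / (rnorm c + 1)); first by rewrite divr_gt0.
exists B => J /hB h; rewrite -mulr_sumr -mulrBr rnormM.
apply: (@le_trans _ _ ((rnorm c + 1) * (e / (rnorm c + 1)))).
  by apply: ler_pM; rewrite ?rnorm_ge0// lerDl.
by rewrite mulrC divfK// gt_eqF.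
Qed.

(** Take for [B] a finite set whose sum is within [e] of the supremum: the sum over
    a set disjoint from [B] adds to that over [B]. *)
Lemma small_tails (c : I -> R) (M : R) : (forall i, 0 <= c i) ->
  (forall J, \sum_(i <- J) c i <= M) ->
  forall e, 0 < e -> exists B, forall J, (forall i, i \in J -> i \notin B) ->
    \sum_(i <- J) c i <= e.
Proof.
move=> c0 cM e e0; pose E := range (fun J : {fset I} => \sum_(i <- J) c i).
have inE' J : E (\sum_(i <- J) c i) by exists J.
have supE : has_sup E.
  by split; [exists (\sum_(i <- fset0) c i), fset0|exists M => _ [J _ <-]].
have [_ [B _ <-] hB] := sup_adherent e0 supE.
exists B => J JB; have := ub_le_sup supE.2 (inE' (B `|` J)%fset).
have -> : \sum_(i <- (B `|` J)%fset) c i = \sum_(i <- B) c i + \sum_(i <- J) c i.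
  rewrite (big_fsetID _ (mem B))/=; congr (_ + _).
    by apply: eq_fbigl => i; rewrite !inE/=; case: (i \in B); case: (i \in J).
  apply: eq_fbigl => i; rewrite !inE/=; move: (JB i).
  by case: (i \in B); case: (i \in J) => //= /(_ isT).
by move: hB => /ltW; lra.
Qed.

Lemma usum_nonneg (c : I -> R) (M : R) : (forall i, 0 <= c i) ->
  (forall J, \sum_(i <- J) c i <= M) ->
  exists s : R, forall e, 0 < e -> exists B, forall J, {subset B <= J} ->
    `|s - \sum_(i <- J) c i| <= e.
Proof.
move=> c0 cM; pose E := range (fun J : {fset I} => \sum_(i <- J) c i).
have inE' J : E (\sum_(i <- J) c i) by exists J.
have supE : has_sup E.
  by split; [exists (\sum_(i <- fset0) c i), fset0|exists M => _ [J _ <-]].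
exists (sup E) => e e0; have [_ [B _ <-] hB] := sup_adherent e0 supE.
exists B => J BJ.
have JE := ub_le_sup supE.2 (inE' J).
have BJs : \sum_(i <- B) c i <= \sum_(i <- J) c i by apply: ler_sum_subset.
by rewrite ger0_norm ?subr_ge0// lerBlDr -lerBlDl ltW// (lt_le_trans hB).
Qed.

(** [c] is the difference of the nonnegative families [|c| + c] and [|c|]. *)
Lemma usum_real (c : I -> R) (M : R) : (forall J, \sum_(i <- J) `|c i| <= M) ->
  exists s : R, forall e, 0 < e -> exists B, forall J, {subset B <= J} ->
    `|s - \sum_(i <- J) c i| <= e.
Proof.
move=> cM.
have [s hs] := usum_nonneg (fun i => normr_ge0 (c i)) cM.
have [|J|t ht] := @usum_nonneg (fun i => `|c i| + c i) (M + M).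
- by move=> i; rewrite -lerBlDr sub0r -normrN ler_norm.
- rewrite big_split/= lerD// (le_trans _ (cM J))// ler_sum// => i _; exact: ler_norm.
exists (t - s) => e e0; have e2 : 0 < e / 2 by rewrite divr_gt0.
have [B hB] := hs _ e2; have [B' hB'] := ht _ e2.
exists (B `|` B')%fset => J BJ.
have /hB h1 : {subset B <= J} by move=> i iB; apply: BJ; rewrite inE iB.
have /hB' : {subset B' <= J} by move=> i iB; apply: BJ; rewrite inE iB orbT.
rewrite big_split/= => h2; set p := \sum_(i <- J) `|c i| in h1 h2.
have -> : t - s - \sum_(i <- J) c i = (t - (p + \sum_(i <- J) c i)) - (s - p) by ring.
by rewrite [e]splitr (le_trans (ler_normB _ _))// lerD.
Qed.

(** Real and imaginary parts are summed separately. *)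
Lemma usum_exists (a : I -> R[i]) (M : R) : (forall J, \sum_(i <- J) rnorm (a i) <= M) ->
  exists s, has_usum a s.
Proof.
move=> aM.
have [J|s hs] := @usum_real (fun i => complex.Re (a i)) M.
  by apply: le_trans (aM J); apply: ler_sum => i _; exact: normr_Re_le.
have [J|t ht] := @usum_real (fun i => complex.Im (a i)) M.
  by apply: le_trans (aM J); apply: ler_sum => i _; exact: normr_Im_le.
exists (Complex s t) => e e0; have e2 : 0 < e / 2 by rewrite divr_gt0.
have [B hB] := hs _ e2; have [B' hB'] := ht _ e2.
exists (B `|` B')%fset => J BJ.
have /hB h1 : {subset B <= J} by move=> i iB; apply: BJ; rewrite inE iB.
have /hB' h2 : {subset B' <= J} by move=> i iB; apply: BJ; rewrite inE iB orbT.
apply: le_trans (ler_rnorm_ReIm _) _; rewrite [e]splitr !raddfB/= !raddf_sum/=.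
by rewrite !sumrN lerD.
Qed.

(** Once [J k] contains the part in [A] of a finite set [B], enlarging [J k] by [B]
    adds only vanishing terms. *)
Lemma has_usum_exhaustion {V : normedZmodType R[i]} (a : I -> V) s (A : set I)
    (J : nat -> {fset I}) :
  has_usum a s -> (forall i, ~ A i -> a i = 0) ->
  (forall B : {fset I}, (forall i, i \in B -> A i) -> \forall k \near \oo, {subset B <= J k}) ->
  (fun k => rnorm (\sum_(i <- J k) a i - s)) @ \oo --> (0 : R).
Proof.
move=> sa a0 hJ; apply/cvgrPdist_le => e /sa[B hB].
have /hJ : forall i, i \in [fset i in B | `[< A i >]]%fset -> A i.
  by move=> i; rewrite !inE/= => /andP[_ /asboolP].
apply: filterS => k sub; rewrite sub0r normrN ger0_norm ?rnorm_ge0// rnormB.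
have -> : \sum_(i <- J k) a i = \sum_(i <- (B `|` J k)%fset) a i.
  apply: big_fset_incl => [|i]; first exact: fsubsetUr.
  rewrite inE => /orP[iB iJ|->//].
  by apply: a0 => Ai; move/negP: iJ; apply; apply: sub; rewrite !inE iB; apply/asboolP.
by apply: hB => i iB; rewrite inE iB.
Qed.

End unconditional_sums.

(** For each [l], the terms outside some finite set are at most [1 / (l + 1)]. *)
Lemma countable_summable_support {R : realType} {I : choiceType} (c : I -> R) (M : R) :
  (forall i, 0 <= c i) -> (forall J : {fset I}, \sum_(i <- J) c i <= M) ->
  countable [set i | c i != 0].
Proof.
move=> c0 cM.
have /choice[B hB] : forall l : nat, exists B : {fset I}, forall i, i \notin B -> c i <= l.+1%:R^-1.
  move=> l; have [|B hB] := small_tails c0 cM (e := l.+1%:R^-1); first by rewrite invr_gt0.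
  exists B => i iB; have := hB [fset i]%fset; rewrite big_seq_fset1; apply.
  by move=> j; rewrite inE => /eqP ->.
apply: (@sub_countable _ _ _ (\bigcup_l [set` B l])); last first.
  by apply: bigcup_countable => // l _; exact/finite_set_countable/finite_fset.
apply: subset_card_le => i /= ci0; apply: contrapT => nB.
have ci : 0 < c i by rewrite lt_neqAle eq_sym ci0 c0.
have [l] := ltr_add_invr ci; rewrite add0r => hl.
have : c i <= l.+1%:R^-1 by apply: hB; apply/negP => iB; apply: nB; exists l.
by rewrite leNgt hl.
Qed.

(** * Samples of the voice transform *)

Section sampling.
Context {R : realType} {X : ptopologicalType} {H : completeNormedModType R[i]}.
Context {I : choiceType}.
Variable mu : {measure set (borel X) -> \bar R}.
Variable dot : {dot H for @Num.conj R[i]}.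
Hypothesis hH : separable_hilbert dot.
Variable phi : X -> H.
Hypothesis hphi : tight_frame mu dot phi.
Variable v : X -> R.
Hypothesis hv : is_weight v.
Variable U : I -> set X.
Hypothesis hU : moderate_covering mu U.
Hypothesis mU : forall i, measurable (U i : set (borel X)).
Hypothesis mufin : forall K : set X, compact K -> (mu K < +oo)%E.
Hypothesis hUm : exists C : R, forall i x y, U i x -> U i y -> assoc_weight v x y <= C.
Variable xi : I -> X.
Hypothesis hxi : forall i, U i (xi i).

Local Notation voice f y := (rnorm (dot f (phi y))).

(** The [H1v] norm, with value [+oo] outside [H1v]. *)
Definition H1v_enorm (g : H) : \bar R := (\int[mu]_y (v y * voice g y)%:E)%E.

Lemma measurable_H1v_integrand (g : H) :
  measurable_fun setT (fun y : borel X => (v y * voice g y)%:E).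
Proof.
apply/measurable_EFinP/measurable_fun_mulr; first exact: measurable_weight hv.
exact: measurable_voice hphi g.
Qed.

Lemma H1v_integrand_ge0 (g : H) y : (0 <= (v y * voice g y)%:E)%E.
Proof. by rewrite lee_fin mulr_ge0 ?rnorm_ge0// (weight_ge0 hv). Qed.

Lemma H1v_enorm_ge0 (g : H) : (0 <= H1v_enorm g)%E.
Proof. by apply: integral_ge0 => y _; exact: H1v_integrand_ge0. Qed.

Lemma Lnorm1_H1v (g : H) :
  Lnorm mu 1%E (fun x : borel X => (v x * rnorm (dot g (phi x)))%:E) = H1v_enorm g.
Proof.
rewrite Lnorm1; apply: eq_integral => y _.
by rewrite gee0_abs// H1v_integrand_ge0.
Qed.

Lemma H1vP (g : H) : H1v mu dot phi v g <-> (H1v_enorm g < +oo)%E.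
Proof.
rewrite /H1v /weighted_Lp/= Lnorm1_H1v; split => [[]//|fin]; split => //.
by have [mf _ _] := hphi; exact: mf.
Qed.

Lemma H1v_normE (g : H) : H1v mu dot phi v g -> (H1v_norm mu dot phi v g)%:E = H1v_enorm g.
Proof.
move=> /H1vP fin; rewrite /H1v_norm/= Lnorm1_H1v fineK//.
by rewrite ge0_fin_numE// H1v_enorm_ge0.
Qed.

Lemma H1v_norm_ge0 (g : H) : 0 <= H1v_norm mu dot phi v g.
Proof. by rewrite /H1v_norm/= Lnorm1_H1v fine_ge0// H1v_enorm_ge0. Qed.

Lemma H1v_enormP (g : H) (a : R[i]) (h : H) :
  (H1v_enorm (a *: g + h)%R <= (rnorm a)%:E * H1v_enorm g + H1v_enorm h)%E.
Proof.
have mg := measurable_H1v_integrand g; have mh := measurable_H1v_integrand h.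
rewrite /H1v_enorm -ge0_integralZl_EFin ?rnorm_ge0//; last first.
  by move=> y _; exact: H1v_integrand_ge0.
rewrite -ge0_integralD//; last 3 first.
- by move=> y _; rewrite mule_ge0 ?H1v_integrand_ge0// lee_fin rnorm_ge0.
- exact: measurable_funeM.
- by move=> y _; exact: H1v_integrand_ge0.
apply: ge0_le_integral => //.
- by move=> y _; exact: H1v_integrand_ge0.
- exact: measurable_H1v_integrand.
- by apply: emeasurable_funD => //; exact: measurable_funeM.
move=> y _; rewrite -EFinM -EFinD lee_fin mulrCA -mulrDr ler_wpM2l ?(weight_ge0 hv)//.
by rewrite linearPl/= (le_trans (ler_rnormD _ _))// rnormM.
Qed.

Lemma H1vZD (a : R[i]) (g h : H) : H1v mu dot phi v g -> H1v mu dot phi v h ->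
  H1v mu dot phi v (a *: g + h).
Proof.
move=> Hg Hh; apply/H1vP; apply: le_lt_trans (H1v_enormP g a h) _.
by rewrite -!H1v_normE// -EFinM -EFinD ltry.
Qed.

Lemma H1v0 : H1v mu dot phi v 0.
Proof.
apply/H1vP; rewrite /H1v_enorm (eq_integral (cst 0%E)) ?integral0 ?ltry// => y _.
by rewrite linear0l rnorm0 mulr0.
Qed.

Lemma H1v_sum (J : {fset I}) (c : I -> R[i]) (g : I -> H) :
  (forall i, H1v mu dot phi v (g i)) ->
  H1v mu dot phi v (\sum_(i <- J) c i *: g i).
Proof.
move=> Hg; elim: (enum_fset J) => [|i s ih]; first by rewrite big_nil; exact: H1v0.
by rewrite big_cons; exact: H1vZD.
Qed.

Lemma H1v_enorm_sum (L : Type) (s : seq L) (c : L -> R[i]) (g : L -> H) :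
  (H1v_enorm (\sum_(i <- s) c i *: g i)%R <=
   \sum_(i <- s) (rnorm (c i))%:E * H1v_enorm (g i))%E.
Proof.
elim: s => [|i s ih].
  rewrite !big_nil /H1v_enorm (eq_integral (cst 0%E)) ?integral0// => y _.
  by rewrite linear0l rnorm0 mulr0.
by rewrite !big_cons (le_trans (H1v_enormP _ _ _))// leeD2l.
Qed.

Lemma weight_sample : exists2 C : R, 0 <= C & forall i x, U i x -> v (xi i) <= C * v x.
Proof.
have [C hC] := hUm; exists (Num.max C 0); first by rewrite le_max lexx orbT.
move=> i x Uix; apply: le_trans (le_assoc_weight hv (xi i) x) _.
by rewrite ler_wpM2r ?(weight_ge0 hv)// le_max (hC i _ _ (hxi i) Uix).
Qed.

Section sampled_family.
Variables (theta : X -> H) (A : R) (K : X -> X -> R).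
Hypothesis hK : schur_bounded mu v A K.
Hypothesis Ktheta : forall x z y, star U x z -> rnorm (dot (phi y) (theta z)) <= K x y.

Lemma kernel_dominates i x y : U i x -> voice (theta (xi i)) y <= K x y.
Proof.
by move=> Uix; rewrite rnorm_dotC; apply: Ktheta; exact: mem_star Uix (hxi i).
Qed.

(** Since [U i] has positive measure, it contains a point at which the row
    integral of the kernel obeys its almost everywhere bound. *)
Lemma H1v_enorm_sample : exists2 C : R, 0 <= C &
  forall i, (H1v_enorm (theta (xi i)) <= (C * v (xi i))%:E)%E.
Proof.
have [C C0 hC] := weight_sample.
have [B hB] := hUm.
exists (A * Num.max B 0); first by rewrite mulr_ge0 ?(schur_const_ge0 hK)// le_max lexx orbT.
move=> i; have [Z [mZ Z0 subZ]] := schur_row hK.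
have [D D0 hD] := cover_measure hU mU mufin; have [UE _ Upos] := hD i.
have [x [Uix Zx]] : exists x, U i x /\ ~ Z x.
  apply: contrapT => nx; have : (mu (U i) <= mu Z)%E.
    apply: le_measure; [by rewrite inE; exact: mU|by rewrite inE|].
    by move=> x Uix; apply: contrapT => Zx; apply: nx; exists x; split.
  by rewrite Z0 UE lee_fin leNgt Upos.
have row : (\int[mu]_y (K x y * assoc_weight v x y)%:E <= A%:E)%E.
  by apply: contrapT => nrow; apply: Zx; apply: (subZ x).
apply: (@le_trans _ _ ((v x)%:E * \int[mu]_y (K x y * assoc_weight v x y)%:E)%E); last first.
  apply: (@le_trans _ _ ((v x)%:E * A%:E)%E).
    by rewrite lee_wpmul2l// lee_fin (weight_ge0 hv).
  rewrite -EFinM lee_fin mulrC -mulrA ler_wpM2l ?(schur_const_ge0 hK)//.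
  apply: le_trans (le_assoc_weight hv x (xi i)) _.
  by rewrite ler_wpM2r ?(weight_ge0 hv)// le_max (hB i x (xi i) Uix (hxi i)).
have mKm := measurable_section1 (measurable_weighted_kernel hv hK) x.
have Km0 y : (0 <= (K x y * assoc_weight v x y)%:E)%E.
  by rewrite lee_fin mulr_ge0 ?(schur_ge0 hK)// (assoc_weight_ge0 hv).
rewrite -ge0_integralZl_EFin ?(weight_ge0 hv)//.
apply: ge0_le_integral => //.
- by move=> y _; exact: H1v_integrand_ge0.
- exact: measurable_H1v_integrand.
- exact: measurable_funeM.
move=> y _; rewrite -EFinM lee_fin mulrCA mulrC.
apply: ler_pM; rewrite ?rnorm_ge0 ?(weight_ge0 hv)//; first exact: kernel_dominates Uix.
by rewrite mulrC assoc_weightC le_assoc_weight.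
Qed.

(** The main estimate: integrating the pointwise bound of [kernel_dominates] over
    [U i] costs a factor at most the inverse of the lower bound of the measures,
    and the sum over [i] is controlled by the finite overlap, so that the
    weighted Schur test applies. *)
Lemma sampled_sum_le : exists2 C : R, 0 <= C & forall (h : X -> R) (J : {fset I}),
  (forall y, 0 <= h y) -> measurable_fun setT (h : borel X -> R) ->
  (\sum_(i <- J) (v (xi i))%:E * \int[mu]_y (h y * voice (theta (xi i)) y)%:E <=
   C%:E * \int[mu]_y (h y * v y)%:E)%E.
Proof.
have [Cm Cm0 hCm] := weight_sample.
have [D D0 hD] := cover_measure hU mU mufin.
have [N hN] := overlap_bound hU.
have A0 := schur_const_ge0 hK; have K0 := schur_ge0 hK.
exists (D^-1 * Cm * N%:R * A); first by rewrite !mulr_ge0// invr_ge0 ltW.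
move=> h J h0 mh.
pose S := frame_support phi.
have mS : measurable S := measurable_frame_support hH hphi.
have sS : sigma_finite S mu := sigma_finite_frame_support hH hphi.
pose Phi (x : X) : \bar R := (\int[mu]_(y in S) (h y * K x y * v x)%:E)%E.
have Phi0 x : (0 <= Phi x)%E.
  by apply: integral_ge0 => y _; rewrite lee_fin !mulr_ge0// (weight_ge0 hv).
have mG : measurable_fun setT (fun z : borel X * borel X => (h z.2 * K z.1 z.2 * v z.1)%:E).
  apply/measurable_EFinP; apply: measurable_fun_mulr.
    apply: measurable_fun_mulr; last exact: schur_measurable hK.
    exact: (measurableT_comp mh measurable_snd).
  exact: (measurableT_comp (measurable_weight hv) measurable_fst).
have G0 (z : borel X * borel X) : (0 <= (h z.2 * K z.1 z.2 * v z.1)%:E)%E.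
  by rewrite lee_fin !mulr_ge0// (weight_ge0 hv).
have mPhi : measurable_fun setT (Phi : borel X -> \bar R).
  exact: (measurable_partial_integral mG G0 mS sS).
pose a i := ((v (xi i))%:E * \int[mu]_y (h y * voice (theta (xi i)) y)%:E)%E.
have mhV i : measurable_fun setT (fun y : borel X => (h y * voice (theta (xi i)) y)%:E).
  by apply/measurable_EFinP/measurable_fun_mulr => //; exact: measurable_voice hphi _.
have hV0 i y : (0 <= (h y * voice (theta (xi i)) y)%:E)%E.
  by rewrite lee_fin mulr_ge0 ?rnorm_ge0.
have a0 i : (0 <= a i)%E.
  by rewrite mule_ge0 ?lee_fin ?(weight_ge0 hv)//; exact: integral_ge0.
(* The pointwise bound at a point of [U i]; the integrand vanishes off [S]. *)
have aPhi i x : U i x -> (a i <= Cm%:E * Phi x)%E.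
  move=> Uix; rewrite /a.
  have -> : (\int[mu]_y (h y * voice (theta (xi i)) y)%:E =
             \int[mu]_(y in S) (h y * voice (theta (xi i)) y)%:E)%E.
    rewrite [RHS]integral_mkcond; apply: eq_integral => y _.
    rewrite patchE; case: ifPn => // /negP; rewrite inE => yS.
    have -> : phi y = 0 by apply: contrapT => /eqP y0; apply: yS.
    by rewrite linear0r rnorm0 mulr0.
  have mk : measurable_fun S (fun y : borel X => (h y * K x y * v x)%:E).
    by apply: measurable_funTS; exact: (measurable_section1 mG x).
  rewrite -!ge0_integralZl_EFin ?(weight_ge0 hv)//; last 2 first.
  - by move=> y _; rewrite lee_fin !mulr_ge0// (weight_ge0 hv).
  - exact: measurable_funTS.
  apply: ge0_le_integral => //.
  - by move=> y _; rewrite mule_ge0// lee_fin (weight_ge0 hv).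
  - exact/measurable_funTS/measurable_funeM.
  - exact: measurable_funeM.
  move=> y _; rewrite -!EFinM lee_fin mulrCA -mulrA [leRHS]mulrCA ler_wpM2l//.
  rewrite mulrC mulrCA ler_pM ?rnorm_ge0 ?(weight_ge0 hv)//.
    exact: kernel_dominates.
  exact: hCm.
(* Only finitely many [U i] enter, so that their union has finite measure. *)
pose W : set (borel X) := \big[setU/set0]_(i <- J) U i.
have mW : measurable W by apply: bigsetU_measurable => i _; exact: mU.
have sW : sigma_finite W mu.
  apply: sigma_finite_finite_measure => //.
  rewrite /W; elim: (enum_fset J) => [|i s ih]; first by rewrite big_nil measure0 ltry.
  rewrite big_cons; apply: le_lt_trans (measureU2 _ _ _) _; first exact: mU.
    by apply: bigsetU_measurable => j _; exact: mU.
  have [UE _ _] := hD i; have Ufin : (mu (U i) < +oo)%E by rewrite UE ltry.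
  by apply: lte_add_pinfty.
have UW i : i \in J -> U i `<=` W.
  by move=> iJ x Uix; rewrite /W -bigcup_fset; exists i.
have step i : i \in J -> (D%:E * a i <= \int[mu]_(x in W) (Cm%:E * ((\1_(U i) x)%:E * Phi x)))%E.
  move=> iJ; apply: (@le_trans _ _ (\int[mu]_(x in U i) a i)%E).
    rewrite (@integral_cst _ (borel X) R mu _ (mU i) (a i)).
    by rewrite muleC lee_wpmul2l//; have [-> ? _] := hD i; rewrite lee_fin.
  apply: (@le_trans _ _ (\int[mu]_(x in U i) (Cm%:E * ((\1_(U i) x)%:E * Phi x)))%E).
    apply: ge0_le_integral => //.
    - apply: measurable_funTS; apply: measurable_funeM; apply: emeasurable_funM => //.
      by apply/measurable_EFinP; exact: measurable_indic.
    - move=> x Uix; rewrite indicE mem_set// mul1e; exact: aPhi.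
  apply: ge0_subset_integral => //.
  - apply: measurable_funTS; apply: measurable_funeM; apply: emeasurable_funM => //.
    by apply/measurable_EFinP; exact: measurable_indic.
  - by move=> x _; rewrite !mule_ge0// lee_fin.
  - exact: UW.
have m1Phi i : measurable_fun W (fun x => Cm%:E * ((\1_(U i) x)%:E * Phi x))%E.
  apply: measurable_funTS; apply: measurable_funeM; apply: emeasurable_funM => //.
  by apply/measurable_EFinP; exact: (@measurable_indic _ (borel X) R setT (U i) (mU i)).
have Phi10 i x : (0 <= Cm%:E * ((\1_(U i) x)%:E * Phi x))%E.
  by rewrite !mule_ge0// lee_fin.
suff le : (D%:E * \sum_(i <- J) a i <= (Cm * N%:R * A)%:E * \int[mu]_y (h y * v y)%:E)%E.
  have -> : (\sum_(i <- J) (v (xi i))%:E * \int[mu]_y (h y * voice (theta (xi i)) y)%:E =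
      D^-1%:E * (D%:E * \sum_(i <- J) a i))%E.
    by rewrite muleA -EFinM mulVf ?gt_eqF// mul1e.
  apply: le_trans (lee_wpmul2l _ le) _; first by rewrite lee_fin invr_ge0 ltW.
  by rewrite muleA -EFinM !mulrA.
rewrite ge0_sume_distrr//.
apply: (@le_trans _ _ (\sum_(i <- J) \int[mu]_(x in W) (Cm%:E * ((\1_(U i) x)%:E * Phi x)))%E).
  by rewrite big_seq [leRHS]big_seq; apply: lee_sum => i; exact: step.
rewrite -ge0_integral_sum//.
apply: (@le_trans _ _ (\int[mu]_(x in W) ((Cm * N%:R)%:E * Phi x))%E).
  apply: ge0_le_integral => //.
  - by move=> x _; apply: sume_ge0.
  - by apply: emeasurable_sum => i; exact: m1Phi.
  - by apply: measurable_funTS; exact: measurable_funeM.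
  move=> x _; under eq_bigr do rewrite muleA -EFinM.
  rewrite -ge0_sume_distrl; last by move=> i _; rewrite lee_fin mulr_ge0.
  rewrite sumEFin lee_wpmul2r// lee_fin [leRHS]mulrC.
  apply: le_trans (sum_indic_le hU x J (c := fun=> Cm) _) _ => //.
  by have [_ leN] := hN x; exact: (sum_indices_at_le hU leN).
rewrite ge0_integralZl_EFin ?mulr_ge0//; last exact: measurable_funTS.
rewrite [X in (_ <= X * _)%E]EFinM -muleA lee_wpmul2l ?lee_fin ?mulr_ge0//.
exact: (schur_test hv hK h0 mh mW sW mS sS).
Qed.

End sampled_family.

(** The two estimates through which the kernel hypotheses enter, for the samples
    [t i = theta (xi i)] of a family [theta]. *)
Definition sampled (t : I -> H) : Prop := exists2 C : R, 0 <= C &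
  (forall i, (H1v_enorm (t i) <= (C * v (xi i))%:E)%E) /\
  forall (h : X -> R) (J : {fset I}),
    (forall y, 0 <= h y) -> measurable_fun setT (h : borel X -> R) ->
    (\sum_(i <- J) (v (xi i))%:E * \int[mu]_y (h y * voice (t i) y)%:E <=
     C%:E * \int[mu]_y (h y * v y)%:E)%E.

Lemma sampled_of_kernel (theta : X -> H) (A : R) (K : X -> X -> R) :
  schur_bounded mu v A K ->
  (forall x z y, star U x z -> rnorm (dot (phi y) (theta z)) <= K x y) ->
  sampled (fun i => theta (xi i)).
Proof.
move=> hK Ktheta.
have [C1 C10 h1] := H1v_enorm_sample hK Ktheta.
have [C2 C20 h2] := sampled_sum_le hK Ktheta.
exists (C1 + C2); first exact: addr_ge0.
split=> [i|h J h0 mh].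
  by apply: le_trans (h1 i) _; rewrite lee_fin ler_wpM2r ?(weight_ge0 hv)// lerDl.
apply: le_trans (h2 h J h0 mh) _; rewrite lee_wpmul2r//.
  by apply: integral_ge0 => y _; rewrite lee_fin mulr_ge0// (weight_ge0 hv).
by rewrite lee_fin lerDr.
Qed.

Section sampled_sequence.
Variable t : I -> H.
Hypothesis ht : sampled t.

Lemma sampled_H1v i : H1v mu dot phi v (t i).
Proof. by have [C _ [h _]] := ht; apply/H1vP; apply: le_lt_trans (h i) _; rewrite ltry. Qed.

Lemma sampled_H1v_norm : exists2 C : R, 0 <= C &
  forall i, H1v_norm mu dot phi v (t i) <= C * v (xi i).
Proof.
have [C C0 [h _]] := ht; exists C => // i.
by rewrite -lee_fin H1v_normE//; exact: sampled_H1v.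
Qed.

(** The integral estimate for [h = |V g|], combined with the Parseval inequality. *)
Lemma sampled_dot_sum : exists2 C : R, 0 <= C &
  forall g (J : {fset I}), H1v mu dot phi v g ->
    \sum_(i <- J) rnorm (dot g (t i)) * v (xi i) <= C * H1v_norm mu dot phi v g.
Proof.
have [C C0 [_ h]] := ht; exists C => // g J Hg.
rewrite -lee_fin EFinM H1v_normE// -sumEFin.
have := h (fun y => voice g y) J (fun y => rnorm_ge0 _) (measurable_voice hphi g).
under [X in (_ <= _ * X)%E -> _]eq_integral do rewrite mulrC.
apply: le_trans; apply: lee_sum => i _.
rewrite EFinM muleC lee_wpmul2l ?lee_fin ?(weight_ge0 hv)//.
exact: (rnorm_dot_le_voice hH hphi).
Qed.

(** The estimate for the functions [1_F / v], with [F] of finite measure, leaves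
    only countably many [i] for which [t i] is not orthogonal to almost all
    [phi y] with [y] in [F]; the support of the frame is covered by countably
    many such [F]. *)
Lemma countable_sampled : countable [set i | t i != 0].
Proof.
have [F [SF hF]] := frame_support_bigcup hH hphi.
have [C C0 [_ hC]] := ht.
pose h k (y : X) := \1_(F k) y * (v y)^-1.
have h0 k y : 0 <= h k y by rewrite mulr_ge0// invr_ge0 (weight_ge0 hv).
have mh k : measurable_fun setT (h k : borel X -> R).
  apply: measurable_fun_mulr; last exact: measurable_inv_weight hv.
  by have [mF _] := hF k; exact: (@measurable_indic _ (borel X) R setT (F k) mF).
pose c k i : \bar R := (\int[mu]_y (h k y * voice (t i) y)%:E)%E.
have c0 k i : (0 <= c k i)%E.
  by apply: integral_ge0 => y _; rewrite lee_fin mulr_ge0 ?rnorm_ge0.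
have hvE k : (\int[mu]_y (h k y * v y)%:E = mu (F k))%E.
  rewrite -[F k]setIT -integral_indic//; last by have [] := hF k.
  apply: eq_integral => y _; rewrite /h -mulrA mulVf ?mulr1//.
  by rewrite gt_eqF// (weight_gt0 hv).
have Ffin k : mu (F k) = (fine (mu (F k)))%:E.
  by have [_ fin] := hF k; rewrite fineK// ge0_fin_numE.
have cM k (J : {fset I}) : (\sum_(i <- J) c k i <= (C * fine (mu (F k)))%:E)%E.
  rewrite EFinM -Ffin -hvE; apply: le_trans (hC (h k) J (h0 k) (mh k)).
  apply: lee_sum => i _; rewrite -[leLHS]mul1e lee_wpmul2r//.
  by rewrite lee_fin (weight_ge1 hv).
have cfin k i : c k i = (fine (c k i))%:E.
  rewrite fineK// ge0_fin_numE// (le_lt_trans _ (ltry (C * fine (mu (F k)))))//.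
  by have := cM k [fset i]%fset; rewrite big_seq_fset1.
have cnt k : countable [set i | fine (c k i) != 0].
  apply: (@countable_summable_support _ _ _ (C * fine (mu (F k)))) => [i|J].
    exact: fine_ge0.
  rewrite -lee_fin -sumEFin; apply: le_trans (cM k J).
  by apply: lee_sum => i _; rewrite -cfin.
apply: (@sub_countable _ _ _ (\bigcup_k [set i | fine (c k i) != 0])); last first.
  exact: bigcup_countable.
apply: subset_card_le => i /= ti0; apply: contrapT => nU.
have ck0 k : c k i = 0%E.
  rewrite cfin; congr (_%:E); apply: contrapT => /eqP ne; apply: nU.
  by exists k.
have ae0 : {ae mu, forall y : borel X, rnorm (dot (t i) (phi y)) = 0}.
  have /ae_foralln : forall k, {ae mu, forall y : borel X, h k y * voice (t i) y = 0}.
    move=> k.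
    have mk : measurable_fun setT (fun y : borel X => (h k y * voice (t i) y)%:E).
      by apply/measurable_EFinP/measurable_fun_mulr => //; exact: measurable_voice hphi _.
    have [+ _] := ae_eq_integral_abs mu measurableT mk.
    have -> : (\int[mu]_y `|(h k y * voice (t i) y)%:E| = c k i)%E.
      by apply: eq_integral => y _; rewrite gee0_abs// lee_fin mulr_ge0 ?rnorm_ge0.
    move=> /(_ (ck0 k)); apply: filterS => y /(_ Logic.I) /=.
    by move=> [].
  apply: filterS => y hy.
  have [Sy|nSy] := pselect (frame_support phi y); last first.
    have -> : phi y = 0 by apply: contrapT => /eqP.
    by rewrite linear0r rnorm0.
  move: Sy; rewrite SF => -[k _ Fky]; have /eqP := hy k.
  rewrite mulf_eq0 /h indicE mem_set//= mul1r invr_eq0 gt_eqF ?(weight_gt0 hv)//=.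
  by move/eqP.
have := rnorm_dot_le_voice hH hphi (t i) (t i).
rewrite (ae_eq_integral (cst 0%E))//; last 2 first.
- by apply/measurable_EFinP/measurable_fun_mulr; exact: measurable_voice hphi _.
- by apply: filterS ae0 => y /= -> _; rewrite mul0r.
rewrite integral0 lee_fin => le0.
move/eqP: ti0; apply; apply: rnorm0_eq0; apply/eqP; rewrite -sqrf_eq0.
rewrite (rnorm_sqr_dot hH) eq_le; apply/andP; split.
  exact: le_trans (ler_Re_rnorm _) le0.
by rewrite -(rnorm_sqr_dot hH) sqr_ge0.
Qed.

End sampled_sequence.

(** * Antilinear functionals and synthesis *)

Local Notation inH1 := (H1v mu dot phi v).
Local Notation normH1 := (H1v_norm mu dot phi v).
Local Notation is_antidual := (antidual mu dot phi v).

Lemma antidual0 f : is_antidual f -> f 0 = 0.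
Proof.
move=> [lin _ _]; have := lin 1 0 0 H1v0 H1v0.
by rewrite scaler0 addr0 conjC1 mul1r => /eqP; rewrite -subr_eq subrr => /eqP.
Qed.

Lemma antidual_sum (L : Type) f (J : seq L) (c : L -> R[i]) (g : L -> H) :
  is_antidual f -> (forall i, inH1 (g i)) ->
  f (\sum_(i <- J) c i *: g i) = \sum_(i <- J) (c i)^* * f (g i).
Proof.
move=> Af Hg; have [lin _ _] := Af.
suff [] : inH1 (\sum_(i <- J) c i *: g i) /\
    f (\sum_(i <- J) c i *: g i) = \sum_(i <- J) (c i)^* * f (g i) by [].
elim: J => [|i s [Hs ih]]; first by rewrite !big_nil antidual0//; split => //; exact: H1v0.
by rewrite !big_cons lin// ih; split => //; exact: H1vZD.
Qed.

Lemma antidual_bound f : is_antidual f ->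
  exists2 C : R, 0 <= C & forall g, inH1 g -> rnorm (f g) <= C * normH1 g.
Proof.
move=> [_ [C hC] _]; exists (Num.max C 0); first by rewrite le_max lexx orbT.
move=> g Hg; apply: le_trans (hC g Hg) _.
by rewrite ler_wpM2r ?H1v_norm_ge0// le_max lexx.
Qed.

Lemma antidual_eq f h : is_antidual f -> is_antidual h ->
  (forall g, inH1 g -> f g = h g) -> f = h.
Proof.
move=> [_ _ f0] [_ _ h0] fh; apply/funext => g.
by have [/fh//|ng] := pselect (inH1 g); rewrite f0// h0.
Qed.

Lemma antidual_finite_sum (n : nat) (s : 'I_n -> H -> R[i]) :
  (forall r, is_antidual (s r)) -> is_antidual (\sum_r s r).
Proof.
move=> hs; split.
- move=> a g h Hg Hh; rewrite !fct_sumE mulr_sumr -big_split/=.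
  by apply: eq_bigr => r _; have [lin _ _] := hs r; exact: lin.
- have /choice[C hC] : forall r, exists C : R, forall g, inH1 g -> rnorm (s r g) <= C * normH1 g.
    by move=> r; have [_ bd _] := hs r.
  exists (\sum_r C r) => g Hg; rewrite fct_sumE mulr_suml.
  by apply: le_trans (ler_rnorm_sum _ _ _) _; apply: ler_sum => r _; exact: hC.
- move=> g ng; rewrite fct_sumE big1// => r _.
  by have [_ _ ->] := hs r.
Qed.

(** The growth of the values of a bounded functional on the atoms; it makes the
    synthesis below converge absolutely. *)
Definition moderate_growth (a : I -> R[i]) : Prop :=
  exists2 L : R, 0 <= L & forall i, rnorm (a i) <= L * v (xi i).

(** The functional [sum_i a i * t i]; like every element of the anti-dual it is
    extended by zero off [H1v]. *)
Definition synthesis (a : I -> R[i]) (t : I -> H) (g : H) : R[i] :=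
  if `[< inH1 g >] then xget 0 [set s | has_usum (fun i => a i * dot (t i) g) s] else 0.

Lemma moderate_growth_antidual f t : is_antidual f -> sampled t ->
  moderate_growth (fun i => f (t i)).
Proof.
move=> /antidual_bound[C C0 hC] ht; have [D D0 hD] := sampled_H1v_norm ht.
exists (C * D) => [|i]; first exact: mulr_ge0.
by rewrite (le_trans (hC _ (sampled_H1v ht i)))// -mulrA ler_wpM2l.
Qed.

Lemma moderate_growth_restrict (a b : I -> R[i]) : moderate_growth a ->
  (forall i, rnorm (b i) <= rnorm (a i)) -> moderate_growth b.
Proof. by move=> [L L0 aL] ba; exists L => // i; exact: le_trans (ba i) (aL i). Qed.

Section synthesis_family.
Variables (a : I -> R[i]) (t : I -> H).
Hypotheses (ha : moderate_growth a) (ht : sampled t).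

Lemma synthesis_terms_bound : exists2 C : R, 0 <= C & forall g (J : {fset I}),
  inH1 g -> \sum_(i <- J) rnorm (a i * dot (t i) g) <= C * normH1 g.
Proof.
have [C C0 hC] := sampled_dot_sum ht; have [L L0 aL] := ha.
exists (L * C) => [|g J Hg]; first exact: mulr_ge0.
rewrite -mulrA; apply: (@le_trans _ _ (L * \sum_(i <- J) rnorm (dot g (t i)) * v (xi i))).
  rewrite mulr_sumr; apply: ler_sum => i _.
  by rewrite rnormM (rnorm_dotC dot g) [leRHS]mulrCA [leLHS]mulrC ler_wpM2l ?rnorm_ge0.
by rewrite ler_wpM2l// hC.
Qed.

Lemma synthesis_usum g : inH1 g -> has_usum (fun i => a i * dot (t i) g) (synthesis a t g).
Proof.
move=> Hg; have [C _ hC] := synthesis_terms_bound.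
rewrite /synthesis ifT; last exact/asboolP.
have [s hs] := usum_exists (fun J => hC g J Hg).
by case: xgetP => [x _ //|/(_ s)].
Qed.

Lemma antidual_synthesis : is_antidual (synthesis a t).
Proof.
split=> [b g h Hg Hh||g ng]; last by rewrite /synthesis ifF//; apply/asboolP.
  apply: has_usum_unique (synthesis_usum (H1vZD b Hg Hh)) _.
  apply: eq_has_usum (has_usumD (has_usumZ b^* (synthesis_usum Hg)) (synthesis_usum Hh)) => i.
  by rewrite linearPr/=; ring.
have [C C0 hC] := synthesis_terms_bound; exists C => g Hg.
exact: has_usum_le (synthesis_usum Hg) (fun J => hC g J Hg).
Qed.

End synthesis_family.

Lemma antidual_to_antidual t i : sampled t -> is_antidual (to_antidual mu dot phi v (t i)).
Proof.
move=> ht; split=> [b g h Hg Hh||g ng].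
- by rewrite /to_antidual !ifT ?linearPr//; apply/asboolP => //; exact: H1vZD.
- have [C C0 hC] := sampled_dot_sum ht; exists C => g Hg.
  rewrite /to_antidual ifT; last exact/asboolP.
  apply: le_trans (hC g [fset i]%fset Hg); rewrite big_seq_fset1 rnorm_dotC.
  by rewrite ler_peMr ?rnorm_ge0// (weight_ge1 hv).
- by rewrite /to_antidual ifF//; apply/asboolP.
Qed.

Lemma antidualZ f (c : R[i]) : is_antidual f -> is_antidual (fun g => c * f g).
Proof.
move=> Af; have [lin _ f0] := Af; have [C C0 hC] := antidual_bound Af.
split=> [b g h Hg Hh||g ng]; last by rewrite f0// mulr0.
  by rewrite lin//; ring.
exists (rnorm c * C) => g Hg; rewrite rnormM -mulrA ler_wpM2l ?rnorm_ge0//.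
exact: hC.
Qed.

Lemma weakstar_synthesis a t : moderate_growth a -> sampled t ->
  sums_weakstar mu dot phi v
    (fun i g => a i * to_antidual mu dot phi v (t i) g) (synthesis a t).
Proof.
move=> ha ht; split; last 2 first.
- exact: antidual_synthesis.
- move=> g Hg.
  have -> : (fun J : {fset I} =>
      partial_sum (fun i g => a i * to_antidual mu dot phi v (t i) g) J g : R[i]^o) =
      partial_sum (fun i => a i * dot (t i) g : R[i]^o).
    apply/funext => J; rewrite !partial_sumE fct_sumE; apply: eq_bigr => i _.
    by rewrite /to_antidual ifT//; apply/asboolP.
  exact/(@has_usum_cvg _ _ R[i]^o)/synthesis_usum.
- by move=> i; apply: antidualZ; exact: antidual_to_antidual.
Qed.

(** * The expansion of functionals *)

Lemma has_usum_dot (a : I -> H) (s g : H) : has_usum a s ->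
  has_usum (fun i => dot g (a i)) (dot g s).
Proof.
move=> sa e e0; have d0 : 0 < rnorm g + 1 by rewrite ltr_wpDl// rnorm_ge0.
have [|B hB] := sa (e / (rnorm g + 1)); first by rewrite divr_gt0.
exists B => J /hB h; rewrite -linear_sumr -linearBr/=.
apply: le_trans (rnorm_dot_CS hH _ _) _.
apply: (@le_trans _ _ ((rnorm g + 1) * (e / (rnorm g + 1)))).
  by apply: ler_pM; rewrite ?rnorm_ge0// lerDl.
by rewrite mulrC divfK// gt_eqF.
Qed.

Section expansion.
Variables (n : nat) (t u : 'I_n -> I -> H).
Hypothesis ht : forall r, sampled (t r).
Hypothesis hu : forall r, sampled (u r).
Hypothesis hexp : forall f : H,
  double_sum (@sums_H R H I) (fun r i => dot f (t r i) *: u r i) f.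

(** Tested against [g], the expansion of [h] becomes a weak expansion of [g] in
    the atoms [t r i], with the roles of the two systems exchanged. *)
Lemma dual_expansion_weak (g h : H) :
  has_usum (fun i => \sum_r dot g (u r i) * dot (t r i) h) (dot g h).
Proof.
have [s [hs hE]] := hexp h; rewrite [X in has_usum _ (dot _ X)]hE linear_sumr/=.
apply: has_usum_finite_sum => r.
have /(has_usum_dot g) : has_usum (fun i => dot h (t r i) *: u r i) (s r).
  exact/has_usum_cvg/hs.
by apply: eq_has_usum => i; rewrite linearZr_LR/= -dotC mulrC.
Qed.

Let partial (g : H) (J : {fset I}) : H :=
  \sum_r \sum_(i <- J) dot g (u r i) *: t r i.

Let partial_dot g J h :
  dot (partial g J) h = \sum_(i <- J) \sum_r dot g (u r i) * dot (t r i) h.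
Proof.
rewrite exchange_big/= linear_sumlz; apply: eq_bigr => r _.
by rewrite linear_sumlz; apply: eq_bigr => i _; rewrite linearZl_LR.
Qed.

Let partialH1 g J : inH1 (partial g J).
Proof.
apply: (big_ind (fun g => inH1 g)) => [|x y Hx Hy|r _]; first exact: H1v0.
  by rewrite -[x]scale1r; exact: H1vZD.
by apply: H1v_sum => i; exact: sampled_H1v.
Qed.

Let atoms := [set i | exists r, u r i != 0].

Let countable_atoms : countable atoms.
Proof.
apply: (@sub_countable _ _ _ (\bigcup_r [set i | u r i != 0])).
  by apply: subset_card_le => i [r h]; exists r.
by apply: bigcup_countable => // r _; exact: countable_sampled.
Qed.

Let not_atoms r i : ~ atoms i -> u r i = 0.
Proof. by move=> na; apply: contrapT => /eqP ne; apply: na; exists r. Qed.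

(** For [g] in [H1v] the weak expansion even converges in the norm of [H1v]: the
    norms of the terms are summable, and Fatou's lemma along an exhaustion of the
    countably many nonzero terms identifies the limit. *)
Lemma dual_expansion_H1v g : inH1 g -> forall e : R, 0 < e ->
  exists B : {fset I}, forall J : {fset I}, {subset B <= J} ->
    (H1v_enorm (g - \sum_r \sum_(i <- J) dot g (u r i) *: t r i)%R <= e%:E)%E.
Proof.
move=> Hg e e0.
have /choice[D hD] : forall r, exists D : R, 0 <= D /\
    forall i, (H1v_enorm (t r i) <= (D * v (xi i))%:E)%E.
  by move=> r; have [D D0 [h _]] := ht r; exists D.
have /choice[C hC] : forall r, exists C : R, forall J : {fset I},
    \sum_(i <- J) rnorm (dot g (u r i)) * v (xi i) <= C * normH1 g.
  by move=> r; have [C _ h] := sampled_dot_sum (hu r); exists C => J; exact: h.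
pose c i := \sum_r D r * (rnorm (dot g (u r i)) * v (xi i)).
have c0 i : 0 <= c i.
  apply: sumr_ge0 => r _; have [D0 _] := hD r.
  by rewrite !mulr_ge0 ?rnorm_ge0// (weight_ge0 hv).
have cM (J : {fset I}) : \sum_(i <- J) c i <= \sum_r D r * (C r * normH1 g).
  rewrite exchange_big/=; apply: ler_sum => r _; rewrite -mulr_sumr ler_wpM2l//.
  by have [] := hD r.
have partial_le (J : {fset I}) : (H1v_enorm (partial g J) <= (\sum_(i <- J) c i)%:E)%E.
  have -> : partial g J = \sum_r (1 : R[i]) *: (\sum_(i <- J) dot g (u r i) *: t r i).
    by apply: eq_bigr => r _; rewrite scale1r.
  apply: le_trans (H1v_enorm_sum _ _ _) _.
  rewrite exchange_big/= -sumEFin; apply: lee_sum => r _.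
  rewrite (_ : rnorm (1 : R[i]) = 1) ?mul1e; last by rewrite /rnorm normr1.
  apply: le_trans (H1v_enorm_sum _ _ _) _; rewrite -sumEFin; apply: lee_sum => i _.
  have [_ /(_ i) h] := hD r; rewrite mulrCA EFinM.
  by rewrite lee_wpmul2l// lee_fin rnorm_ge0.
have [B hB] := small_tails c0 cM e0.
exists B => J BJ; rewrite -/(partial g J).
have [Jk _ hJk] := countable_exhaustion countable_atoms.
(* By Fatou's lemma it suffices to bound the differences [d k] of two partial sums,
   which are sums over sets disjoint from [B]. *)
pose d k : H := partial g (Jk k `|` J)%fset - partial g J.
have dE k : d k = partial g (Jk k `\` J)%fset.
  rewrite /d /partial -sumrB; apply: eq_bigr => r _.
  rewrite (big_fsetID _ (mem J))/= addrC.
  have -> : [fset x in (Jk k `|` J)%fset | x \in J]%fset = J.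
    by apply/fsetP => i; rewrite !inE; case: (i \in J); rewrite ?orbT ?andbF.
  rewrite addrK; congr (\sum_(i <- _) _).
  by congr (enum_fset _); apply/fsetP => i; rewrite !inE; case: (i \in J); rewrite ?orbF ?andbT ?andbF.
have cvgd y : (fun k => rnorm (dot (partial g (Jk k `|` J)%fset) (phi y) - dot g (phi y))) @ \oo --> (0 : R).
  under eq_fun do rewrite partial_dot.
  apply: (has_usum_exhaustion (dual_expansion_weak g (phi y)) (A := atoms)).
    by move=> i na; rewrite big1// => r _; rewrite not_atoms// linear0r mul0r.
  move=> B' /hJk; apply: filterS => k sub i /sub iJ; by rewrite inE iJ.
apply: (@fatou_bound _ _ _ mu (fun k y => (v y * voice (d k) y)%:E)).
- by move=> k; exact: measurable_H1v_integrand.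
- by move=> k y; exact: H1v_integrand_ge0.
- move=> y; apply: cvg_EFin; first exact: nearW.
  rewrite /=; apply: cvgMl_tmp.
  apply/cvgrPdist_le => e' e'0; move/cvgrPdist_le: (cvgd y) => /(_ e' e'0).
  apply: filterS => k; rewrite sub0r normrN ger0_norm ?rnorm_ge0//; apply: le_trans.
  rewrite ler_norml; pose p := partial g (Jk k `|` J)%fset; rewrite -/p.
  have E : dot (g - partial g J) (phi y) - dot (d k) (phi y) = dot g (phi y) - dot p (phi y).
    by rewrite -!linearBl/=; congr (dot _ _); rewrite /d -/p opprB addrA subrK.
  apply/andP; split.
    rewrite lerBrDr addrC lerBlDr; apply: le_trans (ler_rnormB _ (dot (g - partial g J) (phi y))) _.
    by rewrite rnormB E rnormB.
  by rewrite lerBlDr [leRHS]addrC; apply: le_trans (ler_rnormB _ (dot (d k) (phi y))) _; rewrite E rnormB.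
- move=> k; rewrite dE; apply: le_trans (partial_le _) _; rewrite lee_fin; apply: hB.
  by move=> i; rewrite inE => /andP[iJ _]; apply: contra iJ; exact: BJ.
Qed.

(** The functional is applied to the expansion of [g] in the norm of [H1v]. *)
Lemma antidual_expansion_usum f g : is_antidual f -> inH1 g ->
  has_usum (fun i => \sum_r f (t r i) * dot (u r i) g) (f g).
Proof.
move=> Af Hg e e0; have [lin _ _] := Af; have [C C0 hC] := antidual_bound Af.
have C1 : 0 < C + 1 by rewrite ltr_wpDl.
have [|B hB] := dual_expansion_H1v Hg (e := e / (C + 1)); first by rewrite divr_gt0.
exists B => J /hB; rewrite -/(partial g J) => h.
have -> : f g - \sum_(i <- J) \sum_r f (t r i) * dot (u r i) g = f (g - partial g J).
  have -> : f (g - partial g J) = f g - f (partial g J).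
    rewrite [X in f X]addrC -scaleN1r lin//.
    by rewrite rmorphN1 mulN1r addrC.
  congr (_ - _).
  have -> : partial g J = \sum_r (1 : R[i]) *: (\sum_(i <- J) dot g (u r i) *: t r i).
    by apply: eq_bigr => r _; rewrite scale1r.
  rewrite antidual_sum// => [|r]; last by apply: H1v_sum => i; exact: sampled_H1v.
  rewrite exchange_big/=; apply: eq_bigr => r _; rewrite conjC1 mul1r antidual_sum//.
    by apply: eq_bigr => i _; rewrite -dotC mulrC.
  by move=> i; exact: sampled_H1v.
apply: le_trans (hC _ _) _.
  by rewrite -[g]scale1r addrC -scaleN1r; apply: H1vZD; [exact: partialH1|rewrite scale1r].
rewrite -lee_fin EFinM H1v_normE; last first.
  by rewrite addrC -scaleN1r; apply: H1vZD => //; exact: partialH1.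
apply: (@le_trans _ _ ((C + 1)%:E * (e / (C + 1))%:E)%E).
  by apply: lee_pmul; rewrite ?lee_fin ?lerDl// H1v_enorm_ge0.
by rewrite -EFinM lee_fin mulrC divfK// gt_eqF.
Qed.

(** On [H1v] both sides are the unconditional sum of the same family. *)
Lemma antidual_expansion f : is_antidual f ->
  f = \sum_r synthesis (fun i => f (t r i)) (u r).
Proof.
move=> Af; have hs r : is_antidual (synthesis (fun i => f (t r i)) (u r)).
  by apply: antidual_synthesis => //; exact: moderate_growth_antidual.
apply: antidual_eq => //; first exact: antidual_finite_sum.
move=> g Hg; rewrite fct_sumE.
apply: has_usum_unique (antidual_expansion_usum Af Hg) _.
apply: has_usum_finite_sum => r; apply: synthesis_usum => //.
exact: moderate_growth_antidual.
Qed.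

End expansion.

(** * The voice transform of a functional *)

Section reproducing.
Variable AR : R.
Hypothesis hR : schur_bounded mu v AR (fun x y => rnorm (gramian dot phi x y)).

(** [v y <= m x y * v x] turns the row bound of the Gram kernel into a bound of the
    norm of [phi x]. *)
Lemma ae_H1v_frame : {ae mu, forall x : borel X,
  inH1 (phi x) /\ normH1 (phi x) <= AR * v x}.
Proof.
apply: filterS (schur_row hR) => x row.
suff le : (H1v_enorm (phi x) <= (AR * v x)%:E)%E.
  have Hx : inH1 (phi x) by apply/H1vP; apply: le_lt_trans le _; rewrite ltry.
  by split => //; rewrite -lee_fin H1v_normE.
rewrite mulrC EFinM; apply: le_trans (lee_wpmul2l _ row); last first.
  by rewrite lee_fin (weight_ge0 hv).
have mK := measurable_section1 (measurable_weighted_kernel hv hR) x.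
have K0 y : (0 <= (rnorm (gramian dot phi x y) * assoc_weight v x y)%:E)%E.
  by rewrite lee_fin mulr_ge0 ?rnorm_ge0// (assoc_weight_ge0 hv).
rewrite -ge0_integralZl_EFin ?(weight_ge0 hv)//.
apply: ge0_le_integral => //.
- by move=> y _; exact: H1v_integrand_ge0.
- exact: measurable_H1v_integrand.
- exact: measurable_funeM.
move=> y _; rewrite -EFinM lee_fin mulrCA mulrC /gramian (rnorm_dotC dot (phi x)).
by rewrite ler_wpM2l ?rnorm_ge0// mulrC assoc_weightC le_assoc_weight.
Qed.

Let frame_in_H1v : set (borel X) := [set x | inH1 (phi x)].

(** Functionals vanish off this set by convention, so it enters the measurability of
    every voice transform. *)
Let measurable_frame_in_H1v : measurable frame_in_H1v.
Proof.
have mS := measurable_frame_support hH hphi.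
have sS := sigma_finite_frame_support hH hphi.
have mG : measurable_fun setT (fun z : borel X * borel X =>
    (v z.2 * rnorm (gramian dot phi z.1 z.2))%:E).
  apply/measurable_EFinP/measurable_fun_mulr; last exact: schur_measurable hR.
  exact: (measurableT_comp (measurable_weight hv) measurable_snd).
have G0 (z : borel X * borel X) : (0 <= (v z.2 * rnorm (gramian dot phi z.1 z.2))%:E)%E.
  by rewrite lee_fin mulr_ge0 ?rnorm_ge0// (weight_ge0 hv).
have mE : measurable_fun setT (fun x : borel X => H1v_enorm (phi x)).
  apply: eq_measurable_fun (measurable_partial_integral mG G0 mS sS) => x _.
  rewrite /= integral_mkcond; apply: eq_integral => y _.
  rewrite patchE /gramian (rnorm_dotC dot (phi x)); case: ifPn => // /negP; rewrite inE => yS.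
  have -> : phi y = 0 by apply: contrapT => /eqP y0; apply: yS.
  by rewrite linear0r rnorm0 mulr0.
have -> : frame_in_H1v = [set x | (H1v_enorm (phi x) < +oo)%E].
  by apply/seteqP; split => x /H1vP.
rewrite -[X in measurable X]setTI.
exact: emeasurable_fun_infty_o.
Qed.

(** The voice transform of a synthesized functional is a limit of finite sums,
    since all but countably many atoms vanish. *)
Lemma cmeasurable_synthesis (a : I -> R[i]) t : moderate_growth a -> sampled t ->
  cmeasurable (fun x : borel X => synthesis a t (phi x)).
Proof.
move=> ha ht.
have [J _ hJ] := countable_exhaustion (countable_sampled ht).
pose E x : R[i] := (\1_frame_in_H1v x)%:C%C.
apply: (@cmeasurable_limit _ _ _ (fun k x =>
    \sum_(i <- J k) E x * (a i * dot (t i) (phi x)))) => [k|x].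
  apply: cmeasurable_sum => i; apply: cmeasurableM.
    apply: cmeasurable_real.
    exact: (@measurable_indic _ (borel X) R setT _ measurable_frame_in_H1v).
  apply: cmeasurableM; first exact: cmeasurable_cst.
  by have [mf _ _] := hphi; exact: mf.
have [Hx|nHx] := pselect (inH1 (phi x)); last first.
  rewrite (_ : (fun _ => _) = (fun=> 0)); first exact: cvg_cst.
  apply/funext => k; rewrite big1 => [|i _]; last by rewrite /E indicE memNset// mul0r.
  by rewrite /synthesis ifF ?subr0 ?rnorm0//; apply/asboolP.
have us := synthesis_usum ha ht Hx.
have -> : (fun k => rnorm (\sum_(i <- J k) E x * (a i * dot (t i) (phi x)) - synthesis a t (phi x)))
    = (fun k => rnorm (\sum_(i <- J k) (a i * dot (t i) (phi x)) - synthesis a t (phi x))).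
  apply/funext => k; congr (rnorm (_ - _)); apply: eq_bigr => i _.
  by rewrite /E indicE mem_set// mul1r.
apply: (has_usum_exhaustion us (A := [set i | t i != 0])) => //.
by move=> i /negP/negPn/eqP ->; rewrite linear0l mulr0.
Qed.

Section expanded.
Variables (n : nat) (t u : 'I_n -> I -> H).
Hypothesis ht : forall r, sampled (t r).
Hypothesis hu : forall r, sampled (u r).
Hypothesis hexp : forall f : H,
  double_sum (@sums_H R H I) (fun r i => dot f (t r i) *: u r i) f.

Lemma cmeasurable_antidual f : is_antidual f ->
  cmeasurable (fun x : borel X => f (phi x)).
Proof.
move=> Af; rewrite (antidual_expansion ht hu hexp Af).
rewrite (_ : (fun _ => _) = (fun x : borel X =>
    \sum_r synthesis (fun i => f (t r i)) (u r) (phi x))).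
  apply: cmeasurable_sum => r; apply: cmeasurable_synthesis => //.
  exact: moderate_growth_antidual.
by apply/funext => x; rewrite fct_sumE.
Qed.

(** The Parseval inequality [rnorm_dot_le_voice] extends to bounded functionals:
    it holds for the finite partial sums of the expansion, whose voice transforms
    converge almost everywhere and are dominated by a multiple of [v]. *)
Lemma antidual_le_voice f g : is_antidual f -> inH1 g ->
  ((rnorm (f g))%:E <= \int[mu]_y (rnorm (f (phi y)) * voice g y)%:E)%E.
Proof.
move=> Af Hg.
have cA : countable [set i | exists r, u r i != 0].
  apply: (@sub_countable _ _ _ (\bigcup_r [set i | u r i != 0])).
    by apply: subset_card_le => i [r h]; exists r.
  by apply: bigcup_countable => // r _; exact: countable_sampled.
have [J _ hJ] := countable_exhaustion cA.
pose p k : H := \sum_(i <- J k) \sum_r f (t r i) *: u r i.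
have dotp k h : dot (p k) h = \sum_(i <- J k) \sum_r f (t r i) * dot (u r i) h.
  rewrite linear_sumlz; apply: eq_bigr => i _.
  by rewrite linear_sumlz; apply: eq_bigr => r _; rewrite linearZl_LR.
have cvgp h : inH1 h -> (fun k => rnorm (dot (p k) h - f h)) @ \oo --> (0 : R).
  move=> Hh; under eq_fun do rewrite dotp.
  apply: (has_usum_exhaustion (antidual_expansion_usum ht hu hexp Af Hh)
    (A := [set i | exists r, u r i != 0])) => // i na.
  rewrite big1// => r _; rewrite (_ : u r i = 0) ?linear0l ?mulr0//.
  by apply: contrapT => /eqP ne; apply: na; exists r.
have [C C0 hC] : exists2 C : R, 0 <= C & forall k h, inH1 h -> rnorm (dot (p k) h) <= C * normH1 h.
  have /choice[C hC] : forall r, exists C : R, 0 <= C /\ forall h (B : {fset I}),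
      inH1 h -> \sum_(i <- B) rnorm (f (t r i) * dot (u r i) h) <= C * normH1 h.
    move=> r; have [C C0 hC] := synthesis_terms_bound (moderate_growth_antidual Af (ht r)) (hu r).
    by exists C.
  exists (\sum_r C r) => [|k h Hh]; first by apply: sumr_ge0 => r _; have [] := hC r.
  rewrite dotp exchange_big/= mulr_suml; apply: le_trans (ler_rnorm_sum _ _ _) _.
  apply: ler_sum => r _; apply: le_trans (ler_rnorm_sum _ _ _) _.
  by have [_] := hC r; apply.
have mV h : measurable_fun setT (fun y : borel X => voice h y) := measurable_voice hphi h.
have mf := cmeasurable_rnorm (cmeasurable_antidual Af).
have aecvg : {ae mu, forall y : borel X, setT y ->
    (fun k => (voice (p k) y * voice g y)%:E) @ \oo --> (rnorm (f (phi y)) * voice g y)%:E}.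
  apply: filterS ae_H1v_frame => y [Hy _] _.
  apply: cvg_EFin; first exact: nearW.
  apply: cvgMr_tmp; apply/cvgrPdist_le => e e0.
  move/cvgrPdist_le: (cvgp _ Hy) => /(_ e e0); apply: filterS => k.
  rewrite sub0r normrN ger0_norm ?rnorm_ge0//; apply: le_trans.
  set x := f _; set z := dot _ _; rewrite ler_norml rnormB; apply/andP; split.
    by rewrite lerBrDr addrC lerBlDr rnormB ler_rnormB.
  by rewrite lerBlDr [leRHS]addrC ler_rnormB.
have ig : mu.-integrable setT (fun y : borel X => (C * AR)%:E * (v y * voice g y)%:E)%E.
  apply: integrableZl => //; apply/integrableP; split; first exact: measurable_H1v_integrand.
  rewrite (eq_integral (fun y : borel X => (v y * voice g y)%:E)); first exact/H1vP.
  by move=> y _; rewrite gee0_abs// H1v_integrand_ge0.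
have dom : {ae mu, forall (y : borel X) k, setT y ->
    (`|(voice (p k) y * voice g y)%:E| <= (C * AR)%:E * (v y * voice g y)%:E)%E}.
  apply: filterS ae_H1v_frame => y [Hy le] k _.
  rewrite gee0_abs; last by rewrite lee_fin mulr_ge0 ?rnorm_ge0.
  rewrite -EFinM lee_fin mulrA.
  rewrite ler_wpM2r ?rnorm_ge0// -mulrA (le_trans (hC k _ Hy))//.
  by rewrite ler_wpM2l.
have mfk k : measurable_fun setT (fun y : borel X => (voice (p k) y * voice g y)%:E).
  exact/measurable_EFinP/measurable_fun_mulr.
have mlim : measurable_fun setT (fun y : borel X => (rnorm (f (phi y)) * voice g y)%:E).
  exact/measurable_EFinP/measurable_fun_mulr.
have [_ _ cvgint] := dominated_convergence measurableT mfk mlim aecvg ig dom.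
apply/lee_addgt0Pr => e e0; rewrite -leeBlDr//.
apply: cvge_ge cvgint; move/cvgrPdist_le: (cvgp g Hg) => /(_ e e0); apply: filterS => k.
rewrite sub0r normrN ger0_norm ?rnorm_ge0// => le.
apply: le_trans (rnorm_dot_le_voice hH hphi (p k) g); rewrite -EFinB lee_fin lerBlDr.
by apply: le_trans (ler_rnormB _ (dot (p k) g)) _; rewrite lerD2l rnormB.
Qed.

End expanded.

End reproducing.

(** * Norm estimates in the function space *)

Section function_space.
Variable Y : nspace R X.
Hypothesis hY : property_Y mu Y.
Implicit Types (k : X -> X -> R) (F : X -> R) (a : I -> R[i]).

Local Notation cplx F := (fun x : X => (F x)%:C%C).
Local Notation cplx2 k := (fun x y : X => (k x y)%:C%C).

Lemma Y_dominated F (G : X -> R[i]) : measurable_fun setT (F : borel X -> R) ->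
  nmem Y G -> {ae mu, forall x : borel X, `|F x| <= rnorm (G x)} ->
  nmem Y (cplx F) /\ nnorm Y (cplx F) <= nnorm Y G.
Proof.
move=> mF YG FG; apply: (Y_solid hY (cmeasurable_real mF) YG).
apply: filterS FG => x; apply: le_trans.
by rewrite /rnorm normc_def/= expr0n addr0 sqrtr_sqr.
Qed.

Lemma Y_sum (n : nat) (F : 'I_n -> X -> R[i]) : (forall r, nmem Y (F r)) ->
  nmem Y (fun x => \sum_r F r x) /\
  nnorm Y (fun x => \sum_r F r x) <= \sum_r nnorm Y (F r).
Proof.
move=> YF.
have Y0 : nnorm Y (fun=> 0) = 0.
  by have := Y_normZ hY 0 (Y_zero hY); rewrite rnorm0 !mul0r.
elim: n F YF => [|n ih] F YF.
  rewrite (_ : (fun _ => _) = (fun=> 0)); last by apply/funext => x; rewrite big_ord0.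
  by rewrite big_ord0 Y0; split => //; exact: (Y_zero hY).
rewrite (_ : (fun _ => _) = (fun x => F ord_max x + \sum_(r < n) F (widen_ord (leqnSn n) r) x)); last first.
  by apply/funext => x; rewrite big_ord_recr addrC.
have [Ys les] := ih (fun r => F (widen_ord (leqnSn n) r)) (fun r => YF _).
split.
  have := Y_lin hY 1 (YF ord_max) Ys; congr (nmem Y _).
  by apply/funext => x; rewrite mul1r.
rewrite big_ord_recr/= [leRHS]addrC.
by apply: le_trans (Y_normD hY (YF _) Ys) _; rewrite lerD2l.
Qed.

(** For nonnegative kernel and function the complex integral is a real one. *)
Lemma kernel_op_ge k F x : (forall x y, 0 <= k x y) -> (forall y, 0 <= F y) ->
  mu.-integrable setT (fun y : borel X => (rnorm ((k x y)%:C%C * (F y)%:C%C))%:E) ->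
  (\int[mu]_y (k x y * F y)%:E <= (rnorm (kernel_op mu (cplx2 k) (cplx F) x))%:E)%E.
Proof.
move=> k0 F0 int.
have E : (fun y : borel X => (rnorm ((k x y)%:C%C * (F y)%:C%C))%:E) =
         (fun y : borel X => (k x y * F y)%:E).
  by apply/funext => y; rewrite rnormM !rnorm_real.
rewrite E in int.
have ReE : complex.Re (kernel_op mu (cplx2 k) (cplx F) x) =
    fine (\int[mu]_y (k x y * F y)%:E)%E.
  rewrite /kernel_op /cintegral/= /Rintegral; congr (fine _).
  by apply: eq_integral => y _; rewrite mul0r subr0.
rewrite -[leLHS]fineK; last by apply: integrable_fin_num => //; exact: int.
by rewrite -ReE lee_fin ler_Re_rnorm.
Qed.

Lemma indices_measure_pos i : 0 < fine (mu (U i)).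
Proof. by have [D _ /(_ i)[]] := cover_measure hU mU mufin. Qed.

(** Boundedness of the sampling map: the samples over [U i] are bounded by the
    value of one and the same function of [Y] at every point of [U i]. *)
Lemma analysis_bound k : (forall x y, 0 <= k x y) -> kernel_bounded mu Y (cplx2 k) ->
  exists2 C : R, 0 <= C & forall (F : X -> R[i]) a,
    nmem Y F -> countable [set i | a i != 0] ->
    (forall i x, U i x -> ((rnorm (a i))%:E <= \int[mu]_y (rnorm (F y) * k x y)%:E)%E) ->
    nmem (sharp mu U Y) a /\ nnorm (sharp mu U Y) a <= C * nnorm Y F.
Proof.
move=> k0 [C hC]; have [N hN] := overlap_bound hU.
have [D D0 hD] := cover_measure hU mU mufin.
exists (N%:R * D^-1 * Num.max C 0).
  by rewrite !mulr_ge0// ?invr_ge0 ?(ltW D0)// le_max lexx orbT.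
move=> F a YF ca aF.
have mF : cmeasurable (F : borel X -> R[i]) by have [] := Y_L1loc hY YF.
have [Yabs abs_le] : nmem Y (cplx (fun x => rnorm (F x))) /\
    nnorm Y (cplx (fun x => rnorm (F x))) <= nnorm Y F.
  apply: Y_dominated => //; first exact: cmeasurable_rnorm.
  by apply: aeW => x; rewrite ger0_norm// rnorm_ge0.
have [aeint YG G_le] := hC _ Yabs.
set G := kernel_op mu _ _ in YG G_le.
have M0 : 0 <= N%:R * D^-1 :> R by rewrite mulr_ge0// invr_ge0 ltW.
have [YMG MG_le] : nmem Y (fun x => (N%:R * D^-1)%:C%C * G x) /\
    nnorm Y (fun x => (N%:R * D^-1)%:C%C * G x) = N%:R * D^-1 * nnorm Y G.
  split; last by rewrite (Y_normZ hY)// rnorm_real.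
  have := Y_lin hY (N%:R * D^-1)%:C%C YG (Y_zero hY); congr (nmem Y _).
  by apply/funext => x; rewrite addr0.
have [Ysh sh_le] : nmem Y (cplx (sharp_fun mu U a)) /\
    nnorm Y (cplx (sharp_fun mu U a)) <= nnorm Y (fun x => (N%:R * D^-1)%:C%C * G x).
  apply: Y_dominated => //; first exact: (measurable_sharp_fun hU mU).
  apply: filterS aeint => x int.
  rewrite ger0_norm ?(sharp_fun_ge0 hU)// rnormM rnorm_real//.
  rewrite (sharp_funE hU) -mulrA.
  have [_ leN] := hN x; apply: (sum_indices_at_le hU leN).
    by rewrite mulr_ge0 ?rnorm_ge0// invr_ge0 ltW.
  move=> i Uix; rewrite mulrC; have [_ DU _] := hD i.
  apply: ler_pM; rewrite ?rnorm_ge0 ?invr_ge0 ?fine_ge0//.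
    by rewrite lef_pV2 ?posrE//; exact: indices_measure_pos.
  rewrite -lee_fin; apply: le_trans (aF i x Uix) _.
  under eq_integral do rewrite mulrC.
  by apply: kernel_op_ge => // y; exact: rnorm_ge0.
split=> //; apply: le_trans sh_le _; rewrite MG_le -[leRHS]mulrA ler_wpM2l//.
apply: le_trans G_le _.
apply: (@le_trans _ _ (Num.max C 0 * nnorm Y (cplx (fun x => rnorm (F x))))).
  by rewrite ler_wpM2r ?(Y_norm_ge0 hY)// le_max lexx.
by rewrite ler_wpM2l// le_max lexx orbT.
Qed.

(** Boundedness of the synthesis map: over [U i] the voice transform of the atom
    [t i] is bounded by the kernel, so that averaging over [U i] turns the sum of
    the terms into the kernel operator applied to the step function of the
    sequence norm. *)
Lemma synthesis_bound AR k (t : I -> H) :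
  schur_bounded mu v AR (fun x y => rnorm (gramian dot phi x y)) ->
  sampled t ->
  (forall x y, 0 <= k x y) -> kernel_bounded mu Y (cplx2 k) ->
  (forall x, measurable_fun setT (k x : borel X -> R)) ->
  (forall i x y, U i y -> rnorm (dot (t i) (phi x)) <= k x y) ->
  exists2 C : R, 0 <= C & forall a, moderate_growth a ->
    countable [set i | a i != 0] -> nmem (sharp mu U Y) a ->
    nmem (Co mu dot phi v Y) (synthesis a t) /\
    nnorm (Co mu dot phi v Y) (synthesis a t) <= C * nnorm (sharp mu U Y) a.
Proof.
move=> hR ht k0 [C hC] mk tk; exists (Num.max C 0); first by rewrite le_max lexx orbT.
move=> a ha ca Ya.
have [aeint YG G_le] := hC _ Ya.
set G := kernel_op mu _ _ in YG G_le.
suff ae_le : {ae mu, forall x : borel X, rnorm (synthesis a t (phi x)) <= rnorm (G x)}.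
  have [Ys s_le] := Y_solid hY (cmeasurable_synthesis hR ha ht) YG ae_le.
  split; first by split => //; exact: antidual_synthesis.
  apply: le_trans s_le (le_trans G_le _).
  by rewrite ler_wpM2r ?(Y_norm_ge0 hY)// le_max lexx.
have msh := measurable_sharp_fun hU mU ca.
apply: filterS aeint => x int.
have [Hx|nHx] := pselect (inH1 (phi x)); last first.
  by rewrite /synthesis ifF ?rnorm0 ?rnorm_ge0//; apply/asboolP.
apply: (has_usum_le (synthesis_usum ha ht Hx)) => J.
rewrite -lee_fin; apply: le_trans (kernel_op_ge k0 (sharp_fun_ge0 hU a) int).
pose w i := rnorm (a i) * (fine (mu (U i)))^-1.
have w0 i : 0 <= w i by rewrite mulr_ge0 ?rnorm_ge0// invr_ge0 ltW// indices_measure_pos.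
have m1 i : measurable_fun setT (fun y : borel X => \1_(U i) y : R).
  exact: (@measurable_indic _ (borel X) R setT (U i) (mU i)).
have -> : ((\sum_(i <- J) rnorm (a i * dot (t i) (phi x)))%:E =
    \int[mu]_y (\sum_(i <- J) (w i * rnorm (dot (t i) (phi x)))%:E * (\1_(U i) y)%:E))%E.
  rewrite ge0_integral_sum//; last 2 first.
  - by move=> i; apply: measurable_funeM; exact/measurable_EFinP.
  - by move=> i y _; rewrite mule_ge0// lee_fin// mulr_ge0 ?rnorm_ge0.
  rewrite -sumEFin; apply: eq_bigr => i _.
  rewrite ge0_integralZl_EFin//; last 2 first.
  - exact/measurable_EFinP.
  - by rewrite mulr_ge0 ?rnorm_ge0.
  rewrite integral_indic// setIT; have [D _ /(_ i)[-> _ _]] := cover_measure hU mU mufin.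
  by rewrite -EFinM rnormM /w mulrAC mulfVK// gt_eqF// indices_measure_pos.
apply: ge0_le_integral => //.
- by move=> y _; apply: sume_ge0 => i _; rewrite mule_ge0// lee_fin// mulr_ge0 ?rnorm_ge0.
- by apply: emeasurable_sum => i; apply: measurable_funeM; exact/measurable_EFinP.
- by apply/measurable_EFinP/measurable_fun_mulr.
move=> y _; under eq_bigr do rewrite -EFinM.
rewrite sumEFin lee_fin.
apply: le_trans (ler_wpM2l (k0 x y) (partial_sum_le_sharp_fun hU a y J)).
rewrite mulr_sumr; apply: ler_sum => i _; rewrite indicE.
have [Uiy|Uiy] := boolP (y \in U i); last by rewrite !mulr0.
rewrite !mulr1 mulrC ler_wpM2r ?w0//; apply: tk; exact: set_mem.
Qed.

Lemma sharp_dominated a b : countable [set i | b i != 0] ->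
  (forall i, rnorm (b i) <= rnorm (a i)) -> nmem (sharp mu U Y) a ->
  nmem (sharp mu U Y) b /\ nnorm (sharp mu U Y) b <= nnorm (sharp mu U Y) a.
Proof.
move=> cb ba Ya; apply: Y_dominated => //; first exact: (measurable_sharp_fun hU mU).
apply: aeW => x; rewrite ger0_norm ?(sharp_fun_ge0 hU)//.
by rewrite rnorm_real ?(sharp_fun_ge0 hU)// (le_sharp_fun hU).
Qed.

Lemma sharpB a b : countable [set i | a i != 0] -> finite_set [set i | b i != 0] ->
  nmem (sharp mu U Y) a -> nmem (sharp mu U Y) b ->
  nmem (sharp mu U Y) (fun i => a i - b i).
Proof.
move=> ca /finite_set_countable cb Ya Yb.
have Yab := Y_lin hY 1 Ya Yb.
have mab : measurable_fun setT (sharp_fun mu U (fun i => a i - b i) : borel X -> R).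
  apply: (measurable_sharp_fun hU mU).
  apply: (@sub_countable _ _ _
      (\bigcup_(c in [set: bool]) [set i | (if c then a i else b i) != 0])); last first.
    by apply: bigcup_countable => // -[].
  apply: subset_card_le => i /=.
  have [->|a0] := eqVneq (a i) 0; last by exists true.
  by rewrite sub0r oppr_eq0; exists false.
suff le : {ae mu, forall x : borel X, `|sharp_fun mu U (fun i => a i - b i) x| <=
    rnorm (1 * (sharp_fun mu U a x)%:C%C + (sharp_fun mu U b x)%:C%C)}.
  by have [] := Y_dominated mab Yab le.
apply: aeW => x; rewrite ger0_norm ?(sharp_fun_ge0 hU)// mul1r -rmorphD/=.
rewrite rnorm_real ?addr_ge0 ?(sharp_fun_ge0 hU)// !(sharp_funE hU) -big_split/=.
apply: ler_sum => i _; rewrite -mulrDl ler_wpM2r ?invr_ge0 ?fine_ge0//.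
by rewrite -(rnormN (b i)) ler_rnormD.
Qed.

Section tails.
Variables (a : I -> R[i]) (t : I -> H).
Hypotheses (ha : moderate_growth a) (ht : sampled t).

Local Notation term := (fun i g => a i * to_antidual mu dot phi v (t i) g).
Local Notation keep J := (fun i => if i \in J then a i else 0).
Local Notation drop J := (fun i => if i \in J then 0 else a i).

Lemma rnorm_keep (J : {fset I}) i : rnorm (keep J i) <= rnorm (a i).
Proof. by rewrite /=; case: ifP => // _; rewrite rnorm0 rnorm_ge0. Qed.

Lemma rnorm_drop (J : {fset I}) i : rnorm (drop J i) <= rnorm (a i).
Proof. by rewrite /=; case: ifP => // _; rewrite rnorm0 rnorm_ge0. Qed.

Lemma partial_sum_synthesis (J : {fset I}) : partial_sum term J = synthesis (keep J) t.
Proof.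
have hk := moderate_growth_restrict ha (rnorm_keep J).
rewrite partial_sumE; apply/funext => g; rewrite fct_sumE.
have [Hg|nHg] := pselect (inH1 g); last first.
  rewrite /synthesis ifF; last exact/asboolP.
  by rewrite big1// => i _; rewrite /to_antidual ifF ?mulr0//; apply/asboolP.
have := has_usum_fset (J := J) (a := fun i => keep J i * dot (t i) g).
have -> : \sum_(i <- J) keep J i * dot (t i) g =
    \sum_(i <- J) a i * to_antidual mu dot phi v (t i) g.
  rewrite !big_seq; apply: eq_bigr => i iJ; rewrite iJ /to_antidual ifT//.
  exact/asboolP.
move=> us; apply: has_usum_unique (us _) (synthesis_usum hk ht Hg).
by move=> i /negPf ->; rewrite mul0r.
Qed.

Lemma synthesis_tail (J : {fset I}) :
  synthesis a t - partial_sum term J = synthesis (drop J) t.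
Proof.
have hk := moderate_growth_restrict ha (rnorm_keep J).
have hd := moderate_growth_restrict ha (rnorm_drop J).
rewrite partial_sum_synthesis; apply/funext => g; rewrite !fctE.
have [Hg|nHg] := pselect (inH1 g); last first.
  have s0 b : synthesis b t g = 0 by rewrite /synthesis ifF//; apply/asboolP.
  by rewrite !s0 subr0.
rewrite -mulN1r; apply: (has_usum_unique _ (synthesis_usum hd ht Hg)).
apply: eq_has_usum (has_usumD (synthesis_usum ha ht Hg)
  (has_usumZ (-1) (synthesis_usum hk ht Hg))) => i /=.
  by case: ifP; rewrite ?mul0r ?mulr0 ?addr0// mulN1r subrr.
Qed.

(** Approximating the coefficients by a finite sequence [b] controls the tails:
    off the support of [b], the coefficients [a] and [a - b] agree. *)
Lemma sums_Co_synthesis (C : R) : 0 <= C ->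
  (forall b, moderate_growth b -> countable [set i | b i != 0] -> nmem (sharp mu U Y) b ->
    nmem (Co mu dot phi v Y) (synthesis b t) /\
    nnorm (Co mu dot phi v Y) (synthesis b t) <= C * nnorm (sharp mu U Y) b) ->
  countable [set i | a i != 0] -> nmem (sharp mu U Y) a ->
  finite_sequences_dense (sharp mu U Y) ->
  sums_Co mu dot phi v Y term (synthesis a t).
Proof.
move=> C0 hC ca Ya dense.
have sub (b : I -> R[i]) : (forall i, rnorm (b i) <= rnorm (a i)) -> countable [set i | b i != 0].
  move=> ba; apply: sub_countable ca; apply: subset_card_le => i /=.
  apply: contra_neq => ai; apply: rnorm0_eq0; apply: le_anti.
  by rewrite rnorm_ge0 andbT; have := ba i; rewrite ai rnorm0.
have Ysub (b : I -> R[i]) (ba : forall i, rnorm (b i) <= rnorm (a i)) := sharp_dominated (sub b ba) ba Ya.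
split; last 2 first.
- by have [] := hC a ha ca Ya.
- apply/cvgrPdist_le => e e0.
  have [|b [fb Yb abe]] := dense a Ya (e / (C + 1)).
    by rewrite divr_gt0// ltr_wpDl.
  exists (fset_set [set i | b i != 0]) => // J /fsubsetP BJ /=.
  have ba := rnorm_drop J; have [Yd _] := Ysub _ ba.
  have [Cd le_d] := hC _ (moderate_growth_restrict ha ba) (sub _ ba) Yd.
  rewrite sub0r normrN synthesis_tail ger0_norm; last first.
    by apply: (Y_norm_ge0 hY); have [] := Cd.
  have le_ab i : rnorm (drop J i) <= rnorm (a i - b i).
    case: ifPn => iJ; first by rewrite rnorm0 rnorm_ge0.
    have -> : b i = 0; last by rewrite subr0.
    apply: contrapT => /eqP bi; move/negP: iJ; apply; apply: BJ.
    by rewrite in_fset_set// inE.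
  have [_ le_s] := sharp_dominated (sub _ ba) le_ab (sharpB ca fb Ya Yb).
  have C1 : 0 < C + 1 by rewrite ltr_wpDl.
  apply: le_trans le_d _; apply: (@le_trans _ _ ((C + 1) * (e / (C + 1)))).
    apply: ler_pM => //; first exact: (Y_norm_ge0 hY).
      by rewrite lerDl.
    by apply: le_trans le_s _; exact: ltW.
  by rewrite mulrC divfK// gt_eqF.
- move=> i; have := partial_sum_synthesis [fset i]%fset.
  rewrite partial_sumE big_seq_fset1 => ->.
  have ba := rnorm_keep [fset i]%fset; have [Yk _] := Ysub _ ba.
  by have [] := hC _ (moderate_growth_restrict ha ba) (sub _ ba) Yk.
Qed.

End tails.

End function_space.

(** * Oscillation kernels and the discretization theorem *)

Section discretization.

(** The real kernel of which [osc_kernel] is the complex cast. *)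
Definition osc_sup (theta : X -> H) (x y : X) : R :=
  sup [set rnorm (dot (phi y) (theta z)) | z in star U x].

Lemma osc_sup_ub theta x y z : (exists C : R, forall x, rnorm (theta x) <= C) ->
  star U x z -> rnorm (dot (phi y) (theta z)) <= osc_sup theta x y.
Proof.
move=> [C hC] xz; have [_ [C' hC'] _] := hphi.
apply: ub_le_sup; last by exists z.
exists (C' * C) => _ [z' _ <-]; apply: le_trans (rnorm_dot_CS hH _ _) _.
by apply: ler_pM; rewrite ?rnorm_ge0.
Qed.

Lemma osc_sup_ge0 theta x y : (exists C : R, forall x, rnorm (theta x) <= C) ->
  0 <= osc_sup theta x y.
Proof.
move=> bd; have [z xz] := star_nonempty hU x.
exact: le_trans (rnorm_ge0 _) (osc_sup_ub y bd xz).
Qed.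

Variable Y : nspace R X.
Hypothesis hY : property_Y mu Y.
Variable AR : R.
Hypothesis hR : schur_bounded mu v AR (fun x y => rnorm (gramian dot phi x y)).
Variables (n : nat) (psi psit : 'I_n -> X -> H).
Hypothesis bpsi : forall r, exists C : R, forall x, rnorm (psi r x) <= C.
Hypothesis bpsit : forall r, exists C : R, forall x, rnorm (psit r x) <= C.
Hypothesis hK : forall r, BYm mu Y (assoc_weight v) (osc_kernel U dot phi (psi r)).
Hypothesis hKt : forall r, BYm mu Y (assoc_weight v)
  (fun x y => osc_kernel U dot phi (psit r) y x).
Hypothesis hexp : forall f : H, double_sum (@sums_H R H I)
  (fun r i => dot f (psi r (xi i)) *: psit r (xi i)) f.

Let t r i := psi r (xi i).
Let u r i := psit r (xi i).
Let coef (f : H -> R[i]) r i := f (t r i).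

Let schur_osc r : exists A, schur_bounded mu v A (osc_sup (psi r)).
Proof.
have [A [A0 _ mK row col]] := Am_schur (hK r).1.
have E x y : rnorm (osc_kernel U dot phi (psi r) x y) = osc_sup (psi r) x y.
  by rewrite rnorm_real// osc_sup_ge0.
exists A; have -> : osc_sup (psi r) = (fun x y => rnorm (osc_kernel U dot phi (psi r) x y)).
  by apply/funext => x; apply/funext => y; rewrite E.
by split => // x y; exact: rnorm_ge0.
Qed.

Let schur_osct r : exists A, schur_bounded mu v A (fun x y => osc_sup (psit r) y x).
Proof.
have [A [A0 _ mK row col]] := Am_schur (hKt r).1.
have E x y : rnorm (osc_kernel U dot phi (psit r) y x) = osc_sup (psit r) y x.
  by rewrite rnorm_real// osc_sup_ge0.
exists A; have -> : (fun x y => osc_sup (psit r) y x) =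
    (fun x y => rnorm (osc_kernel U dot phi (psit r) y x)).
  by apply/funext => x; apply/funext => y; rewrite E.
by split => // x y; exact: rnorm_ge0.
Qed.

Let ht r : sampled (t r).
Proof.
have [A hA] := schur_osc r.
by apply: (sampled_of_kernel hA) => x z y; exact: osc_sup_ub.
Qed.

Let hu r : sampled (u r).
Proof.
have [A /(schur_transpose) hA] := schur_osct r.
by apply: (sampled_of_kernel hA) => x z y; exact: osc_sup_ub.
Qed.

Let countable_coef f r : is_antidual f -> countable [set i | coef f r i != 0].
Proof.
move=> Af; apply: sub_countable (countable_sampled (ht r)); apply: subset_card_le => i /=.
by apply: contra_neq => ti0; rewrite /coef ti0 antidual0.
Qed.

Let coef_growth f r : is_antidual f -> moderate_growth (coef f r).
Proof. by move=> Af; exact: moderate_growth_antidual. Qed.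

Let analysis r : exists2 C : R, 0 <= C & forall f, nmem (Co mu dot phi v Y) f ->
  nmem (sharp mu U Y) (coef f r) /\
  nnorm (sharp mu U Y) (coef f r) <= C * nnorm (Co mu dot phi v Y) f.
Proof.
have [A hA] := schur_osc r.
have [C C0 hC] := analysis_bound hY (fun x y => osc_sup_ge0 x y (bpsi r)) (hK r).2.
exists C => // f [Af Yf]; apply: hC => //; first exact: countable_coef.
move=> i x Uix; apply: le_trans (antidual_le_voice hR ht hu hexp Af (sampled_H1v (ht r) i)) _.
have mf := cmeasurable_rnorm (cmeasurable_antidual hR ht hu hexp Af).
apply: ge0_le_integral => //.
- by move=> y _; rewrite lee_fin mulr_ge0 ?rnorm_ge0.
- by apply/measurable_EFinP/measurable_fun_mulr => //; exact: measurable_voice hphi _.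
- apply/measurable_EFinP/measurable_fun_mulr => //.
  exact: (measurableT_comp (schur_measurable hA) (measurable_pair1 (x : borel X))).
move=> y _; rewrite lee_fin ler_wpM2l ?rnorm_ge0// rnorm_dotC.
by apply: osc_sup_ub => //; exact: mem_star Uix (hxi i).
Qed.

Let synthesis_Co r : exists2 C : R, 0 <= C & forall a, moderate_growth a ->
  countable [set i | a i != 0] -> nmem (sharp mu U Y) a ->
  nmem (Co mu dot phi v Y) (synthesis a (u r)) /\
  nnorm (Co mu dot phi v Y) (synthesis a (u r)) <= C * nnorm (sharp mu U Y) a.
Proof.
have [A hA] := schur_osct r.
apply: (synthesis_bound hY hR (hu r) (fun x y => osc_sup_ge0 y x (bpsit r)) (hKt r).2).
  move=> x.
  exact: (measurableT_comp (schur_measurable hA) (measurable_pair1 (x : borel X))).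
move=> i x y Uiy; rewrite rnorm_dotC.
by apply: osc_sup_ub => //; exact: mem_star Uiy (hxi i).
Qed.

Let Co_sum (s : 'I_n -> H -> R[i]) : (forall r, nmem (Co mu dot phi v Y) (s r)) ->
  nmem (Co mu dot phi v Y) (\sum_r s r) /\
  nnorm (Co mu dot phi v Y) (\sum_r s r) <= \sum_r nnorm (Co mu dot phi v Y) (s r).
Proof.
move=> hs; have [Ysum le] := Y_sum hY (fun r => (hs r).2).
have E : (fun x => (\sum_r s r) (phi x)) = (fun x => \sum_r s r (phi x)).
  by apply/funext => x; rewrite fct_sumE.
split; last by rewrite /Co/= E.
by split; [apply: antidual_finite_sum => r; have [] := hs r|rewrite E].
Qed.

Lemma discretization :
  [/\ forall f, nmem (Co mu dot phi v Y) f -> double_sum (sums_weakstar mu dot phi v)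
        (fun r i g => f (t r i) * to_antidual mu dot phi v (u r i) g) f,
      forall f, is_antidual f ->
        (nmem (Co mu dot phi v Y) f <-> forall r, nmem (sharp mu U Y) (coef f r)),
      exists c C : R, [/\ 0 < c, 0 < C & forall f, nmem (Co mu dot phi v Y) f ->
        c * nnorm (Co mu dot phi v Y) f <= \sum_(r < n) nnorm (sharp mu U Y) (coef f r)
        /\ \sum_(r < n) nnorm (sharp mu U Y) (coef f r)
             <= C * nnorm (Co mu dot phi v Y) f] &
      finite_sequences_dense (sharp mu U Y) -> forall f, nmem (Co mu dot phi v Y) f ->
        double_sum (sums_Co mu dot phi v Y)
          (fun r i g => f (t r i) * to_antidual mu dot phi v (u r i) g) f].
Proof.
have /choice[Ca hCa] : forall r, exists C : R, 0 <= C /\ forall f,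
    nmem (Co mu dot phi v Y) f -> nmem (sharp mu U Y) (coef f r) /\
    nnorm (sharp mu U Y) (coef f r) <= C * nnorm (Co mu dot phi v Y) f.
  by move=> r; have [C C0 h] := analysis r; exists C.
have /choice[Cs hCs] : forall r, exists C : R, 0 <= C /\ forall a, moderate_growth a ->
    countable [set i | a i != 0] -> nmem (sharp mu U Y) a ->
    nmem (Co mu dot phi v Y) (synthesis a (u r)) /\
    nnorm (Co mu dot phi v Y) (synthesis a (u r)) <= C * nnorm (sharp mu U Y) a.
  by move=> r; have [C C0 h] := synthesis_Co r; exists C.
have expand f : is_antidual f -> f = \sum_r synthesis (coef f r) (u r).
  exact: antidual_expansion.
have sharp_ge0 a : nmem (sharp mu U Y) a -> 0 <= nnorm (sharp mu U Y) a.
  exact: (Y_norm_ge0 hY).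
have back f : is_antidual f -> (forall r, nmem (sharp mu U Y) (coef f r)) ->
    nmem (Co mu dot phi v Y) f /\
    nnorm (Co mu dot phi v Y) f <= \sum_r Cs r * nnorm (sharp mu U Y) (coef f r).
  move=> Af Ysh.
  have hs r := (hCs r).2 _ (coef_growth r Af) (countable_coef r Af) (Ysh r).
  have [Cof le] := Co_sum (fun r => (hs r).1); rewrite (expand f Af); split => //.
  apply: le_trans le _; apply: ler_sum => r _; rewrite -(expand f Af).
  by have [_] := hs r.
split.
- move=> f [Af _]; exists (fun r => synthesis (coef f r) (u r)); split; last exact: expand.
  by move=> r; exact: (weakstar_synthesis (coef_growth r Af) (hu r)).
- move=> f Af; split=> [Cof r|/(back f Af)[]//].
  by have [_ /(_ f Cof)[]] := hCa r.
- have S0 (C : 'I_n -> R) : (forall r, 0 <= C r) -> 0 < 1 + \sum_r C r.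
    by move=> C0; rewrite ltr_wpDr// sumr_ge0.
  have Cs0 r : 0 <= Cs r by have [] := hCs r.
  have Ca0 r : 0 <= Ca r by have [] := hCa r.
  have le1 (C : 'I_n -> R) r : (forall r, 0 <= C r) -> C r <= 1 + \sum_r C r.
    move=> C0; rewrite (bigD1 r)//= addrCA lerDl addr_ge0//.
    by apply: sumr_ge0.
  exists (1 + \sum_r Cs r)^-1, (1 + \sum_r Ca r).
  split; rewrite ?invr_gt0 ?S0// => f Cof.
  have Ysh r : nmem (sharp mu U Y) (coef f r) by have [_ /(_ f Cof)[]] := hCa r.
  split.
    rewrite mulrC ler_pdivrMr ?S0//.
    have [_] := back f Cof.1 Ysh; move/le_trans; apply.
    rewrite mulr_suml; apply: ler_sum => r _.
    by rewrite mulrC ler_wpM2l ?sharp_ge0 ?le1.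
  apply: (@le_trans _ _ (\sum_r Ca r * nnorm (Co mu dot phi v Y) f)).
    by apply: ler_sum => r _; have [_ /(_ f Cof)[]] := hCa r.
  by rewrite -mulr_suml ler_wpM2r ?(Y_norm_ge0 hY) ?lerDr//; have [] := Cof.
- move=> dense f Cof; have Af := Cof.1.
  exists (fun r => synthesis (coef f r) (u r)); split; last exact: expand.
  move=> r; have [Cr0 hCr] := hCs r; have [_ /(_ f Cof)[Yr _]] := hCa r.
  exact: (sums_Co_synthesis hY (coef_growth r Af) (hu r) Cr0 hCr (countable_coef r Af) Yr dense).
Qed.

End discretization.

End sampling.

Theorem theorem3p14
  (R : realType)
  (H : completeNormedModType R[i]) (dot : {dot H for @Num.conj R[i]})
  (hH : separable_hilbert dot)
  (X : ptopologicalType)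
  (hXhausdorff : hausdorff_space X) (hXlc : locally_compact [set: X])
  (mu : {measure set (borel X) -> \bar R}) (hmu : radon_full_support mu)
  (Y : nspace R X) (hY : property_Y mu Y)
  (v : X -> R) (hv : is_weight v)
  (I : choiceType) (U : I -> set X)
  (hU : moderate_covering mu U)
  (hUY : forall i, nmem Y (fun x => (\1_(U i) x)%:C%C))
  (hUm : exists C : R, forall i x y, U i x -> U i y -> assoc_weight v x y <= C)
  (hsharp : nmem (sharp mu U Y) `<=`
            nmem (sharp mu U (weighted_Lp mu +oo%E (fun x => (v x)^-1))))
  (phi : X -> H) (hphi : tight_frame mu dot phi)
  (hF : property_F mu dot phi v Y)
  (n : nat) (psi psit : 'I_n -> X -> H)
  (hpsi : forall r, continuous_frame mu dot (psi r))
  (hpsit : forall r, continuous_frame mu dot (psit r))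
  (hpsi1 : forall r x, H1v mu dot phi v (psi r x))
  (hpsit1 : forall r x, H1v mu dot phi v (psit r x))
  (hK : forall r, BYm mu Y (assoc_weight v) (osc_kernel U dot phi (psi r)))
  (hKt : forall r, BYm mu Y (assoc_weight v)
                     (fun x y => osc_kernel U dot phi (psit r) y x))
  (xi : I -> X) (hxi : forall i, U i (xi i))
  (hexp : forall f : H,
     double_sum (@sums_H R H I)
       (fun r i => dot f (psi r (xi i)) *: psit r (xi i)) f) :
  let CoY := Co mu dot phi v Y in
  let Ysharp := sharp mu U Y in
  let expansion_term (f : H -> R[i]) (r : 'I_n) (i : I) : H -> R[i] :=
    fun g => f (psi r (xi i)) * to_antidual mu dot phi v (psit r (xi i)) g in
  [/\ forall f, nmem CoY f ->
        double_sum (sums_weakstar mu dot phi v) (expansion_term f) f,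
      forall f, antidual mu dot phi v f ->
        (nmem CoY f <-> forall r, nmem Ysharp (fun i => f (psi r (xi i)))),
      exists c C : R, [/\ 0 < c, 0 < C & forall f, nmem CoY f ->
        c * nnorm CoY f <= \sum_(r < n) nnorm Ysharp (fun i => f (psi r (xi i)))
        /\ \sum_(r < n) nnorm Ysharp (fun i => f (psi r (xi i)))
             <= C * nnorm CoY f] &
      finite_sequences_dense Ysharp -> forall f, nmem CoY f ->
        double_sum (sums_Co mu dot phi v Y) (expansion_term f) f].
Proof.
move=> CoY Ysharp expansion_term.
have mU i : measurable (U i : set (borel X)).
  have [[mRe _] _] := Y_L1loc hY (hUY i).
  by apply/(@measurable_indicP _ (borel X) R).
have mufin := radon_compact hmu.
have [AR hR] := Am_schur hF.1.1.
have bounded theta : continuous_frame mu dot theta -> exists C : R, forall x, rnorm (theta x) <= C.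
  by move=> [C1 [C2 [_ _ [_ bd _]]]].
exact: (discretization hH hphi hv hU mU mufin hUm hxi hY hR
  (fun r => bounded _ (hpsi r)) (fun r => bounded _ (hpsit r)) hK hKt hexp).
Qed.
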